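(* Let $(\mathcal{C},K,\theta)$ be a locally finite abelian ribbon Grothendieck–Verdier category and let $A$ be a commutative algebra in $\mathcal{C}$ such that $\theta_A^2=\mathrm{id}_A$. If the abelian braided monoidal category $\mathcal{C}_A^{\mathrm{loc}}$ is rigid and every simple object of $\mathcal{C}_A$ is an object of $\mathcal{C}_A^{\mathrm{loc}}$, then $\mathcal{C}_A$ is rigid.
   Context: A locally finite abelian category is a $\mathbb{K}$-linear abelian category ($\mathbb{K}$ a field) with finite-dimensional morphism spaces and finite-length objects; tensor products are assumed $\mathbb{K}$-bilinear. An object $K$ of a monoidal category $\mathcal{C}$ is dualizing if for every $X\in\mathcal{C}$ the functor $\mathrm{Hom}_{\mathcal{C}}(-\otimes X,K)$ is representable and the resulting contravariant functor $D$ is an anti-equivalence. Representability means that there are an object $DX$ and a morphism $e_X:DX\otimes X\to K$ such that for every $f:Y\otimes X\to K$ there is a unique $\varphi:Y\to DX$ with $e_X\circ(\varphi\otimes\mathrm{id}_X)=f$. On $f:X\to Y$, $Df:DY\to DX$ is the unique morphism with $e_X\circ(Df\otimes\mathrm{id}_X)=e_Y\circ(\mathrm{id}_{DY}\otimes f)$. A ribbon Grothendieck–Verdier category $(\mathcal{C},K,\theta)$ is a braided monoidal category (braiding $c$) with a dualizing object $K$ and a natural isomorphism $\theta:\mathrm{id}_{\mathcal{C}}\to\mathrm{id}_{\mathcal{C}}$ satisfying $\theta_{X\otimes Y}=c_{Y,X}\circ c_{X,Y}\circ(\theta_X\otimes\theta_Y)$ and $D\theta_X=\theta_{DX}$ for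 all $X,Y$. A monoidal category is rigid if every object has a left and a right dual. An algebra $(A,\mu_A,\iota_A)$ is commutative if $\mu_A\circ c_{A,A}=\mu_A$. The category $\mathcal{C}_A$ of left $A$-modules $(M,\mu_M)$ is monoidal with unit $A$: $M\otimes_A N$ is the coequalizer of $\mu_M\otimes\mathrm{id}_N$ and $(\mathrm{id}_M\otimes\mu_N)\circ(c_{A,M}\otimes\mathrm{id}_N)$ from $A\otimes M\otimes N$ to $M\otimes N$. $\mathcal{C}_A^{\mathrm{loc}}\subseteq\mathcal{C}_A$ is the full subcategory of modules with $\mu_M\circ c_{M,A}\circ c_{A,M}=\mu_M$; it is monoidal under $\otimes_A$, with braiding induced by $c$. *)

(* Defs.v *)
From mathcomp Require Import all_boot all_algebra.
From mathcomp Require Import boolp.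

Set Implicit Arguments.
Unset Strict Implicit.
Unset Printing Implicit Defensive.

Import GRing.Theory.

Declare Scope cat_scope.
Delimit Scope cat_scope with cat.
Local Open Scope cat_scope.

Reserved Notation "f ∘ g" (at level 51, right associativity).
Reserved Notation "X ⊗ Y" (at level 40, left associativity).
Reserved Notation "f ⊠ g" (at level 40, left associativity).

Record category_struct (ob : Type) (hom : ob -> ob -> Type) := CategoryStruct {
  cs_id : forall X, hom X X;
  cs_comp : forall X Y Z, hom Y Z -> hom X Y -> hom X Z;
  cs_id_l : forall X Y (f : hom X Y), cs_comp (cs_id Y) f = f;
  cs_id_r : forall X Y (f : hom X Y), cs_comp f (cs_id X) = f;
  cs_assoc : forall X Y Z W (h : hom Z W) (g : hom Y Z) (f : hom X Y),
    cs_comp h (cs_comp g f) = cs_comp (cs_comp h g) f }.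

Record category := Category {
  ob :> Type;
  hom : ob -> ob -> Type;
  cat_struct : category_struct hom }.

Arguments hom {_}.

Definition idm {C : category} (X : C) : hom X X := cs_id (cat_struct C) X.
Definition comp {C : category} {X Y Z : C} (g : hom Y Z) (f : hom X Y) :
  hom X Z := cs_comp (cat_struct C) g f.
Notation "g ∘ f" := (comp g f) : cat_scope.

Section CategoryTheory.
Context {C : category}.
Implicit Types X Y Z W : C.

Definition is_iso X Y (f : hom X Y) : Prop :=
  exists g : hom Y X, g ∘ f = idm X /\ f ∘ g = idm Y.

Definition is_mono X Y (f : hom X Y) : Prop :=
  forall Z (u v : hom Z X), f ∘ u = f ∘ v -> u = v.

Definition is_epi X Y (f : hom X Y) : Prop :=
  forall Z (u v : hom Y Z), u ∘ f = v ∘ f -> u = v.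

Definition is_coequalizer X Y Q (f g : hom X Y) (q : hom Y Q) : Prop :=
  q ∘ f = q ∘ g /\
  forall Z (h : hom Y Z), h ∘ f = h ∘ g -> exists! u : hom Q Z, u ∘ q = h.

Definition zero_object Z : Prop :=
  forall X, (exists! f : hom X Z, True) /\ (exists! f : hom Z X, True).

Definition simple_object X : Prop :=
  ~ zero_object X /\
  forall Y (i : hom Y X), is_mono i -> zero_object Y \/ is_iso i.

Lemma comp_id_l X Y (f : hom X Y) : idm Y ∘ f = f.
Proof. exact: cs_id_l. Qed.

Lemma comp_id_r X Y (f : hom X Y) : f ∘ idm X = f.
Proof. exact: cs_id_r. Qed.

Lemma comp_assoc X Y Z W (h : hom Z W) (g : hom Y Z) (f : hom X Y) :
  h ∘ (g ∘ f) = (h ∘ g) ∘ f.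
Proof. exact: cs_assoc. Qed.

Lemma comp_eq X Y Z W (f : hom Y Z) (g : hom X Y) (h : hom X Z) (k : hom W X) :
  f ∘ g = h -> f ∘ (g ∘ k) = h ∘ k.
Proof. by move=> <-; rewrite comp_assoc. Qed.

Lemma comp_eq3 X Y Y' Z W (f : hom Y Z) (g : hom Y' Y) (h : hom X Y')
    (l : hom X Z) (k : hom W X) :
  f ∘ g ∘ h = l -> f ∘ (g ∘ (h ∘ k)) = l ∘ k.
Proof. by move=> <-; rewrite !comp_assoc. Qed.

Lemma comp_eq2 X Y Y' Z W (f : hom Y Z) (g : hom X Y) (f' : hom Y' Z)
    (g' : hom X Y') (k : hom W X) :
  f ∘ g = f' ∘ g' -> f ∘ (g ∘ k) = f' ∘ (g' ∘ k).
Proof. by move=> E; rewrite !comp_assoc E. Qed.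

Lemma is_epi_comp X Y Z (g : hom Y Z) (f : hom X Y) :
  is_epi g -> is_epi f -> is_epi (g ∘ f).
Proof. by move=> gE fE W u v; rewrite !comp_assoc => /fE /gE. Qed.

Lemma is_iso_epi X Y (f : hom X Y) : is_iso f -> is_epi f.
Proof.
move=> [g [_ fg]] Z u v E.
by rewrite -(comp_id_r u) -(comp_id_r v) -fg !comp_assoc E.
Qed.

Lemma split_epi X Y (f : hom X Y) (g : hom Y X) : f ∘ g = idm Y -> is_epi f.
Proof.
move=> fg Z u v E.
by rewrite -(comp_id_r u) -(comp_id_r v) -fg !comp_assoc E.
Qed.

Lemma split_mono X Y (f : hom X Y) (g : hom Y X) : g ∘ f = idm X -> is_mono f.
Proof.
move=> gf Z u v E.
by rewrite -(comp_id_l u) -(comp_id_l v) -gf -!comp_assoc E.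
Qed.

Lemma coequalizer_epi X Y Q (f g : hom X Y) (q : hom Y Q) :
  is_coequalizer f g q -> is_epi q.
Proof.
move=> [qE qU] Z u v E.
have [|w [_ wU]] := qU Z (u ∘ q); first by rewrite -!comp_assoc qE.
by rewrite -(wU u erefl) (wU v (esym E)).
Qed.

End CategoryTheory.

Record functor (C D : category) := Functor {
  fob :> C -> D;
  fmap : forall X Y : C, hom X Y -> hom (fob X) (fob Y);
  fmap_id : forall X, fmap (idm X) = idm (fob X);
  fmap_comp : forall X Y Z (g : hom Y Z) (f : hom X Y),
    fmap (g ∘ f) = fmap g ∘ fmap f }.

Arguments fmap {C D} _ {X Y}.

Definition id_functor (C : category) : functor C C :=
  @Functor C C id (fun _ _ f => f) (fun _ => erefl) (fun _ _ _ _ _ => erefl).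

Section CompFunctor.
Variables (C D E : category) (G : functor D E) (F : functor C D).

Fact comp_fmap_id (X : C) : fmap G (fmap F (idm X)) = idm (G (F X)).
Proof. by rewrite !fmap_id. Qed.

Fact comp_fmap_comp (X Y Z : C) (g : hom Y Z) (f : hom X Y) :
  fmap G (fmap F (g ∘ f)) = fmap G (fmap F g) ∘ fmap G (fmap F f).
Proof. by rewrite !fmap_comp. Qed.

Definition comp_functor : functor C E := Functor comp_fmap_id comp_fmap_comp.
End CompFunctor.

Record nat_iso (C D : category) (F G : functor C D) := NatIso {
  nat_map :> forall X : C, hom (F X) (G X);
  nat_map_iso : forall X, is_iso (nat_map X);
  nat_mapP : forall (X Y : C) (f : hom X Y),
    nat_map Y ∘ fmap F f = fmap G f ∘ nat_map X }.

Definition is_equivalence (C D : category) (F : functor C D) : Prop :=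
  exists G : functor D C,
    inhabited (nat_iso (comp_functor G F) (id_functor C)) /\
    inhabited (nat_iso (comp_functor F G) (id_functor D)).

Section Opposite.
Variable C : category.

Definition opp_struct : category_struct (fun X Y : C => hom Y X) :=
  @CategoryStruct C (fun X Y => hom Y X) (fun X => idm X)
    (fun X Y Z g f => f ∘ g) (fun X Y f => comp_id_r f)
    (fun X Y f => comp_id_l f) (fun X Y Z W h g f => esym (comp_assoc f g h)).

Definition opposite : category := Category opp_struct.
End Opposite.

Record linear_category (k : fieldType) := LinearCategory {
  lin_ob : Type;
  lin_hom : lin_ob -> lin_ob -> vectType k;
  lin_struct : category_struct (fun X Y => lin_hom X Y : Type);
  lin_comp_linear_l : forall X Y Z (g : lin_hom Y Z) (a : k)
      (f f' : lin_hom X Y),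
    cs_comp lin_struct g (a *: f + f')%R =
    (a *: cs_comp lin_struct g f + cs_comp lin_struct g f')%R;
  lin_comp_linear_r : forall X Y Z (f : lin_hom X Y) (a : k)
      (g g' : lin_hom Y Z),
    cs_comp lin_struct (a *: g + g')%R f =
    (a *: cs_comp lin_struct g f + cs_comp lin_struct g' f)%R }.

Definition category_of_linear k (C : linear_category k) : category :=
  Category (lin_struct C).
Coercion category_of_linear : linear_category >-> category.

Section Abelian.
Context {k : fieldType} {C : linear_category k}.
Implicit Types X Y Z : C.

Definition zerom X Y : hom X Y := (0 : lin_hom X Y)%R.
Definition addm X Y (f g : hom X Y) : hom X Y :=
  ((f : lin_hom X Y) + g)%R.
Definition scalem X Y (a : k) (f : hom X Y) : hom X Y :=
  (a *: (f : lin_hom X Y))%R.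

Definition is_kernel N X Y (i : hom N X) (f : hom X Y) : Prop :=
  f ∘ i = zerom N Y /\
  forall Z (h : hom Z X), f ∘ h = zerom Z Y -> exists! u : hom Z N, i ∘ u = h.

Definition is_cokernel X Y Q (p : hom Y Q) (f : hom X Y) : Prop :=
  p ∘ f = zerom X Q /\
  forall Z (h : hom Y Z), h ∘ f = zerom X Z -> exists! u : hom Q Z, u ∘ p = h.

Definition is_biproduct X Y P (i1 : hom X P) (i2 : hom Y P)
    (p1 : hom P X) (p2 : hom P Y) : Prop :=
  [/\ p1 ∘ i1 = idm X, p2 ∘ i2 = idm Y, p1 ∘ i2 = zerom Y X,
      p2 ∘ i1 = zerom X Y & addm (i1 ∘ p1) (i2 ∘ p2) = idm P].

(* [X] has a finite filtration with simple successive quotients. *)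
Inductive finite_length : C -> Prop :=
| finite_length_zero X : zero_object X -> finite_length X
| finite_length_ext X Y S (i : hom Y X) (p : hom X S) :
    is_mono i -> is_cokernel p i -> finite_length Y -> simple_object S ->
    finite_length X.
End Abelian.

Record is_abelian k (C : linear_category k) : Prop := IsAbelian {
  abelian_zero : exists Z : C, zero_object Z;
  abelian_biproduct : forall X Y : C, exists P (i1 : hom X P) (i2 : hom Y P)
    (p1 : hom P X) (p2 : hom P Y), is_biproduct i1 i2 p1 p2;
  abelian_kernel : forall (X Y : C) (f : hom X Y),
    exists N (i : hom N X), is_kernel i f;
  abelian_cokernel : forall (X Y : C) (f : hom X Y),
    exists Q (p : hom Y Q), is_cokernel p f;
  abelian_mono : forall (X Y : C) (f : hom X Y), is_mono f ->
    exists Z (g : hom Y Z), is_kernel f g;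
  abelian_epi : forall (X Y : C) (f : hom X Y), is_epi f ->
    exists Z (g : hom Z X), is_cokernel f g }.

(* Finite-dimensionality of the morphism spaces is part of [linear_category],
   where they are vectTypes. *)
Record locally_finite_abelian_category (k : fieldType) := LFACategory {
  lfa_linear :> linear_category k;
  lfa_abelian : is_abelian lfa_linear;
  lfa_finite_length : forall X : lfa_linear, finite_length X }.

Record monoidal_struct (C : category) := MonoidalStruct {
  ms_unit : C;
  ms_tens : C -> C -> C;
  ms_map : forall X X' Y Y' : C, hom X X' -> hom Y Y' ->
    hom (ms_tens X Y) (ms_tens X' Y');
  ms_a : forall X Y Z,
    hom (ms_tens (ms_tens X Y) Z) (ms_tens X (ms_tens Y Z));
  ms_a' : forall X Y Z,
    hom (ms_tens X (ms_tens Y Z)) (ms_tens (ms_tens X Y) Z);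
  ms_l : forall X, hom (ms_tens ms_unit X) X;
  ms_l' : forall X, hom X (ms_tens ms_unit X);
  ms_r : forall X, hom (ms_tens X ms_unit) X;
  ms_r' : forall X, hom X (ms_tens X ms_unit);
  ms_map_id : forall X Y, ms_map (idm X) (idm Y) = idm (ms_tens X Y);
  ms_map_comp : forall X X' X'' Y Y' Y'' (g : hom X' X'') (f : hom X X')
      (g' : hom Y' Y'') (f' : hom Y Y'),
    ms_map (g ∘ f) (g' ∘ f') = ms_map g g' ∘ ms_map f f';
  ms_aK : forall X Y Z, ms_a' X Y Z ∘ ms_a X Y Z = idm _;
  ms_a'K : forall X Y Z, ms_a X Y Z ∘ ms_a' X Y Z = idm _;
  ms_lK : forall X, ms_l' X ∘ ms_l X = idm _;
  ms_l'K : forall X, ms_l X ∘ ms_l' X = idm _;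
  ms_rK : forall X, ms_r' X ∘ ms_r X = idm _;
  ms_r'K : forall X, ms_r X ∘ ms_r' X = idm _;
  ms_a_nat : forall X X' Y Y' Z Z' (f : hom X X') (g : hom Y Y')
      (h : hom Z Z'),
    ms_a X' Y' Z' ∘ ms_map (ms_map f g) h =
    ms_map f (ms_map g h) ∘ ms_a X Y Z;
  ms_l_nat : forall X Y (f : hom X Y),
    ms_l Y ∘ ms_map (idm ms_unit) f = f ∘ ms_l X;
  ms_r_nat : forall X Y (f : hom X Y),
    ms_r Y ∘ ms_map f (idm ms_unit) = f ∘ ms_r X;
  ms_pentagon : forall X Y Z W,
    ms_map (idm X) (ms_a Y Z W) ∘ (ms_a X (ms_tens Y Z) W ∘
      ms_map (ms_a X Y Z) (idm W)) =
    ms_a X Y (ms_tens Z W) ∘ ms_a (ms_tens X Y) Z W;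
  ms_triangle : forall X Y,
    ms_map (idm X) (ms_l Y) ∘ ms_a X ms_unit Y = ms_map (ms_r X) (idm Y) }.

Record monoidal_category := MonoidalCategory {
  mon_cat :> category;
  mon_struct : monoidal_struct mon_cat }.

Definition munit {C : monoidal_category} : C := ms_unit (mon_struct C).
Definition tens {C : monoidal_category} (X Y : C) : C :=
  ms_tens (mon_struct C) X Y.
Definition tensm {C : monoidal_category} {X X' Y Y' : C} (f : hom X X')
  (g : hom Y Y') : hom (tens X Y) (tens X' Y') := ms_map (mon_struct C) f g.
Notation "X ⊗ Y" := (tens X Y) : cat_scope.
Notation "f ⊠ g" := (tensm f g) : cat_scope.

Section MonoidalTheory.
Context {C : monoidal_category}.
Implicit Types X Y Z W : C.

Definition assoc X Y Z : hom ((X ⊗ Y) ⊗ Z) (X ⊗ (Y ⊗ Z)) :=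
  ms_a (mon_struct C) X Y Z.
Definition assoc' X Y Z : hom (X ⊗ (Y ⊗ Z)) ((X ⊗ Y) ⊗ Z) :=
  ms_a' (mon_struct C) X Y Z.
Definition lunit X : hom (munit ⊗ X) X := ms_l (mon_struct C) X.
Definition lunit' X : hom X (munit ⊗ X) := ms_l' (mon_struct C) X.
Definition runit X : hom (X ⊗ munit) X := ms_r (mon_struct C) X.
Definition runit' X : hom X (X ⊗ munit) := ms_r' (mon_struct C) X.

(* [Y] is a left dual of [X], equivalently [X] is a right dual of [Y]. *)
Definition is_left_dual Y X : Prop :=
  exists (ev : hom (Y ⊗ X) munit) (coev : hom munit (X ⊗ Y)),
    runit X ∘ (idm X ⊠ ev) ∘ assoc X Y X ∘ (coev ⊠ idm X) ∘ lunit' X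
      = idm X /\
    lunit Y ∘ (ev ⊠ idm Y) ∘ assoc' Y X Y ∘ (idm Y ⊠ coev) ∘ runit' Y
      = idm Y.
End MonoidalTheory.

Definition rigid (C : monoidal_category) : Prop :=
  forall X : C, (exists Y, is_left_dual Y X) /\ (exists Y, is_left_dual X Y).

Record braiding (C : monoidal_category) := Braiding {
  br : forall X Y : C, hom (X ⊗ Y) (Y ⊗ X);
  br' : forall X Y : C, hom (Y ⊗ X) (X ⊗ Y);
  br_K : forall X Y, br' X Y ∘ br X Y = idm _;
  br_'K : forall X Y, br X Y ∘ br' X Y = idm _;
  br_nat : forall (X X' Y Y' : C) (f : hom X X') (g : hom Y Y'),
    br X' Y' ∘ (f ⊠ g) = (g ⊠ f) ∘ br X Y;
  br_hexagon : forall X Y Z,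
    assoc Y Z X ∘ br X (Y ⊗ Z) ∘ assoc X Y Z =
    (idm Y ⊠ br X Z) ∘ assoc Y X Z ∘ (br X Y ⊠ idm Z);
  br_hexagon' : forall X Y Z,
    assoc' Z X Y ∘ br (X ⊗ Y) Z ∘ assoc' X Y Z =
    (br X Z ⊠ idm Y) ∘ assoc' X Z Y ∘ (idm X ⊠ br Y Z) }.

Record braided_category := BraidedCategory {
  braid_mon :> monoidal_category;
  braid_struct : braiding braid_mon }.

Definition braid {C : braided_category} (X Y : C) : hom (X ⊗ Y) (Y ⊗ X) :=
  br (braid_struct C) X Y.
Definition braid' {C : braided_category} (X Y : C) : hom (Y ⊗ X) (X ⊗ Y) :=
  br' (braid_struct C) X Y.

Section MonoidalLemmas.
Context {C : monoidal_category}.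
Implicit Types X Y Z W : C.

Lemma tensm_id X Y : idm X ⊠ idm Y = idm (X ⊗ Y).
Proof. exact: ms_map_id. Qed.

Lemma tensm_comp X X' X'' Y Y' Y'' (g : hom X' X'') (f : hom X X')
    (g' : hom Y' Y'') (f' : hom Y Y') :
  (g ∘ f) ⊠ (g' ∘ f') = (g ⊠ g') ∘ (f ⊠ f').
Proof. exact: ms_map_comp. Qed.

Lemma tensm_compl X X' X'' Y (g : hom X' X'') (f : hom X X') :
  (g ∘ f) ⊠ idm Y = (g ⊠ idm Y) ∘ (f ⊠ idm Y).
Proof. by rewrite -tensm_comp comp_id_l. Qed.

Lemma tensm_compr X X' X'' Y (g : hom X' X'') (f : hom X X') :
  idm Y ⊠ (g ∘ f) = (idm Y ⊠ g) ∘ (idm Y ⊠ f).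
Proof. by rewrite -tensm_comp comp_id_l. Qed.

Lemma tensm_lr X X' Y Y' (f : hom X X') (g : hom Y Y') :
  f ⊠ g = (f ⊠ idm Y') ∘ (idm X ⊠ g).
Proof. by rewrite -tensm_comp comp_id_l comp_id_r. Qed.

Lemma tensm_rl X X' Y Y' (f : hom X X') (g : hom Y Y') :
  f ⊠ g = (idm X' ⊠ g) ∘ (f ⊠ idm Y).
Proof. by rewrite -tensm_comp comp_id_l comp_id_r. Qed.

Lemma tensm_swap X X' Y Y' (f : hom X X') (g : hom Y Y') :
  (f ⊠ idm Y') ∘ (idm X ⊠ g) = (idm X' ⊠ g) ∘ (f ⊠ idm Y).
Proof. by rewrite -tensm_lr tensm_rl. Qed.

Lemma assocK X Y Z : assoc' X Y Z ∘ assoc X Y Z = idm _.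
Proof. exact: ms_aK. Qed.
Lemma assoc'K X Y Z : assoc X Y Z ∘ assoc' X Y Z = idm _.
Proof. exact: ms_a'K. Qed.
Lemma lunitK X : lunit' X ∘ lunit X = idm _. Proof. exact: ms_lK. Qed.
Lemma lunit'K X : lunit X ∘ lunit' X = idm _. Proof. exact: ms_l'K. Qed.
Lemma runitK X : runit' X ∘ runit X = idm _. Proof. exact: ms_rK. Qed.
Lemma runit'K X : runit X ∘ runit' X = idm _. Proof. exact: ms_r'K. Qed.

Lemma assoc_nat X X' Y Y' Z Z' (f : hom X X') (g : hom Y Y') (h : hom Z Z') :
  assoc X' Y' Z' ∘ ((f ⊠ g) ⊠ h) = (f ⊠ (g ⊠ h)) ∘ assoc X Y Z.
Proof. exact: ms_a_nat. Qed.

Lemma assoc'_nat X X' Y Y' Z Z' (f : hom X X') (g : hom Y Y') (h : hom Z Z') :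
  assoc' X' Y' Z' ∘ (f ⊠ (g ⊠ h)) = ((f ⊠ g) ⊠ h) ∘ assoc' X Y Z.
Proof.
rewrite -[LHS]comp_id_r -(assoc'K X Y Z) -comp_assoc.
by rewrite -(comp_eq2 _ (assoc_nat f g h)) (comp_eq _ (assocK _ _ _)) comp_id_l.
Qed.

Lemma lunit_nat X Y (f : hom X Y) : lunit Y ∘ (idm munit ⊠ f) = f ∘ lunit X.
Proof. exact: ms_l_nat. Qed.

Lemma runit_nat X Y (f : hom X Y) : runit Y ∘ (f ⊠ idm munit) = f ∘ runit X.
Proof. exact: ms_r_nat. Qed.

Lemma lunit'_nat X Y (f : hom X Y) : lunit' Y ∘ f = (idm munit ⊠ f) ∘ lunit' X.
Proof.
rewrite -[LHS]comp_id_r -(lunit'K X) -comp_assoc.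
by rewrite -(comp_eq2 _ (lunit_nat f)) (comp_eq _ (lunitK _)) comp_id_l.
Qed.

Lemma runit'_nat X Y (f : hom X Y) : runit' Y ∘ f = (f ⊠ idm munit) ∘ runit' X.
Proof.
rewrite -[LHS]comp_id_r -(runit'K X) -comp_assoc.
by rewrite -(comp_eq2 _ (runit_nat f)) (comp_eq _ (runitK _)) comp_id_l.
Qed.

Lemma pentagon X Y Z W :
  (idm X ⊠ assoc Y Z W) ∘ assoc X (Y ⊗ Z) W ∘ (assoc X Y Z ⊠ idm W) =
  assoc X Y (Z ⊗ W) ∘ assoc (X ⊗ Y) Z W.
Proof. exact: ms_pentagon. Qed.

Lemma pentagon_l X Y Z W :
  assoc (X ⊗ Y) Z W ∘ (assoc' X Y Z ⊠ idm W) ∘ assoc' X (Y ⊗ Z) W =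
  assoc' X Y (Z ⊗ W) ∘ (idm X ⊠ assoc Y Z W).
Proof.
apply: (split_mono (assocK X Y (Z ⊗ W))).
rewrite (comp_eq2 _ (esym (pentagon X Y Z W))) [RHS](comp_eq _ (assoc'K _ _ _)).
rewrite comp_id_l -!comp_assoc (comp_eq _ (esym (tensm_compl _ _ _))) assoc'K.
by rewrite tensm_id comp_id_l assoc'K comp_id_r.
Qed.

Lemma pentagon' X Y Z W :
  (assoc' X Y Z ⊠ idm W) ∘ assoc' X (Y ⊗ Z) W ∘ (idm X ⊠ assoc' Y Z W) =
  assoc' (X ⊗ Y) Z W ∘ assoc' X Y (Z ⊗ W).
Proof.
apply: (split_mono (assocK (X ⊗ Y) Z W)).
rewrite (comp_eq3 _ (pentagon_l X Y Z W)) -!comp_assoc -tensm_compr assoc'K.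
by rewrite tensm_id comp_id_r comp_assoc assoc'K comp_id_l.
Qed.

Lemma pentagon_r X Y Z W :
  assoc' X (Y ⊗ Z) W ∘ (idm X ⊠ assoc' Y Z W) ∘ assoc X Y (Z ⊗ W) =
  (assoc X Y Z ⊠ idm W) ∘ assoc' (X ⊗ Y) Z W.
Proof.
rewrite -[LHS]comp_id_l -tensm_id -(assoc'K X Y Z) tensm_compl -comp_assoc.
by rewrite (comp_eq3 _ (pentagon' X Y Z W)) -!comp_assoc assocK comp_id_r.
Qed.

Lemma triangle X Y :
  (idm X ⊠ lunit Y) ∘ assoc X munit Y = runit X ⊠ idm Y.
Proof. exact: ms_triangle. Qed.

Lemma assoc_epi X Y Z : is_epi (assoc X Y Z).
Proof. exact: split_epi (assoc'K X Y Z). Qed.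
Lemma assoc'_epi X Y Z : is_epi (assoc' X Y Z).
Proof. exact: split_epi (assocK X Y Z). Qed.
Lemma assoc_mono X Y Z : is_mono (assoc X Y Z).
Proof. exact: split_mono (assocK X Y Z). Qed.
Lemma assoc'_mono X Y Z : is_mono (assoc' X Y Z).
Proof. exact: split_mono (assoc'K X Y Z). Qed.

Lemma unit_tensm_inj X Y (f g : hom X Y) :
  idm munit ⊠ f = idm munit ⊠ g -> f = g.
Proof.
move=> E; apply: (split_epi (lunit'K X)).
by rewrite -!lunit_nat E.
Qed.

Lemma tensm_unit_inj X Y (f g : hom X Y) :
  f ⊠ idm munit = g ⊠ idm munit -> f = g.
Proof.
move=> E; apply: (split_epi (runit'K X)).
by rewrite -!runit_nat E.
Qed.

Lemma lunit_assoc X Y : lunit (X ⊗ Y) ∘ assoc munit X Y = lunit X ⊠ idm Y.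
Proof.
apply: unit_tensm_inj.
have aE : is_epi (assoc munit munit X ⊠ idm Y).
  apply: (@split_epi _ _ _ _ (assoc' munit munit X ⊠ idm Y)).
  by rewrite -tensm_compl assoc'K tensm_id.
apply/(is_epi_comp (@assoc_epi munit (munit ⊗ X) Y) aE).
rewrite tensm_compr -comp_assoc pentagon.
rewrite (comp_eq _ (triangle _ _)) -tensm_id -assoc_nat -triangle tensm_compl.
by rewrite comp_assoc assoc_nat -!comp_assoc.
Qed.

Lemma runit_assoc X Y : (idm X ⊠ runit Y) ∘ assoc X Y munit = runit (X ⊗ Y).
Proof.
apply: tensm_unit_inj; apply: assoc_mono.
rewrite tensm_compl comp_assoc assoc_nat -comp_assoc.
rewrite -triangle tensm_compr -comp_assoc pentagon.
by rewrite -(comp_eq2 _ (assoc_nat _ _ _)) tensm_id triangle.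
Qed.

End MonoidalLemmas.

Section BraidedLemmas.
Context {C : braided_category}.
Implicit Types X Y Z W : C.

Lemma braidK X Y : braid' X Y ∘ braid X Y = idm _. Proof. exact: br_K. Qed.
Lemma braid'K X Y : braid X Y ∘ braid' X Y = idm _. Proof. exact: br_'K. Qed.

Lemma braid_nat X X' Y Y' (f : hom X X') (g : hom Y Y') :
  braid X' Y' ∘ (f ⊠ g) = (g ⊠ f) ∘ braid X Y.
Proof. exact: br_nat. Qed.

Lemma braid'_nat X X' Y Y' (f : hom X X') (g : hom Y Y') :
  braid' X' Y' ∘ (g ⊠ f) = (f ⊠ g) ∘ braid' X Y.
Proof.
rewrite -[LHS]comp_id_r -(braid'K X Y) -comp_assoc.
by rewrite -(comp_eq2 _ (braid_nat f g)) (comp_eq _ (braidK _ _)) comp_id_l.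
Qed.

Lemma hexagon X Y Z :
  assoc Y Z X ∘ braid X (Y ⊗ Z) ∘ assoc X Y Z =
  (idm Y ⊠ braid X Z) ∘ assoc Y X Z ∘ (braid X Y ⊠ idm Z).
Proof. exact: br_hexagon. Qed.

Lemma hexagon' X Y Z :
  assoc' Z X Y ∘ braid (X ⊗ Y) Z ∘ assoc' X Y Z =
  (braid X Z ⊠ idm Y) ∘ assoc' X Z Y ∘ (idm X ⊠ braid Y Z).
Proof. exact: br_hexagon'. Qed.

Lemma braid_tensl X Y Z :
  braid (X ⊗ Y) Z =
  assoc Z X Y ∘ (braid X Z ⊠ idm Y) ∘ assoc' X Z Y ∘ (idm X ⊠ braid Y Z)
    ∘ assoc X Y Z.
Proof.
apply: assoc'_mono; rewrite [RHS](comp_eq _ (assocK _ _ _)) comp_id_l.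
apply: assoc'_epi; rewrite -!comp_assoc assoc'K comp_id_r.
exact: hexagon'.
Qed.

Lemma braid'_tensl X Y Z :
  braid' (X ⊗ Y) Z =
  assoc' X Y Z ∘ (idm X ⊠ braid' Y Z) ∘ assoc X Z Y ∘ (braid' X Z ⊠ idm Y)
    ∘ assoc' Z X Y.
Proof.
apply: (split_mono (braidK (X ⊗ Y) Z)); rewrite braid'K braid_tensl.
rewrite -!comp_assoc (comp_eq _ (assoc'K _ _ _)) comp_id_l.
rewrite (comp_eq _ (esym (tensm_compr _ _ _))) braid'K tensm_id comp_id_l.
rewrite (comp_eq _ (assocK _ _ _)) comp_id_l.
rewrite (comp_eq _ (esym (tensm_compl _ _ _))) braid'K tensm_id comp_id_l.
by rewrite assoc'K.
Qed.

Lemma braid'_tensr X Y Z :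
  braid' X (Y ⊗ Z) =
  assoc X Y Z ∘ (braid' X Y ⊠ idm Z) ∘ assoc' Y X Z ∘ (idm Y ⊠ braid' X Z)
    ∘ assoc Y Z X.
Proof.
apply: (split_mono (braidK X (Y ⊗ Z))); rewrite braid'K.
apply: assoc_mono; rewrite comp_id_r.
rewrite [RHS](_ : _ = (assoc Y Z X ∘ braid X (Y ⊗ Z) ∘ assoc X Y Z) ∘
  (braid' X Y ⊠ idm Z) ∘ assoc' Y X Z ∘ (idm Y ⊠ braid' X Z) ∘ assoc Y Z X);
  last by rewrite -!comp_assoc.
rewrite hexagon -!comp_assoc.
rewrite (comp_eq _ (esym (tensm_compl _ _ _))) braid'K tensm_id comp_id_l.
rewrite (comp_eq _ (assoc'K _ _ _)) comp_id_l.
by rewrite (comp_eq _ (esym (tensm_compr _ _ _))) braid'K tensm_id comp_id_l.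
Qed.

Lemma runit_braid X : runit X ∘ braid munit X = lunit X.
Proof.
apply: tensm_unit_inj; rewrite -lunit_assoc.
apply: (@assoc'_epi _ munit X munit); rewrite -comp_assoc assoc'K comp_id_r.
apply: (@split_epi _ _ _ (idm munit ⊠ braid munit X) (idm munit ⊠ braid' munit X)).
  by rewrite -tensm_compr braid'K tensm_id.
apply: (@assoc_epi _ munit munit X).
rewrite lunit_nat -!comp_assoc lunit_assoc braid_nat braid_tensl.
by rewrite [RHS](comp_eq _ (triangle _ _)) (comp_eq _ (esym (tensm_compl _ _ _))).
Qed.
End BraidedLemmas.

Record dual_data (C : monoidal_category) := DualData {
  dual_base : C;
  dual : C -> C;
  dual_ev : forall X : C, hom (dual X ⊗ X) dual_base;
  dual_rep : forall (X Y : C) (f : hom (Y ⊗ X) dual_base),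
    exists! phi : hom Y (dual X), dual_ev X ∘ (phi ⊠ idm X) = f }.

Section Dual.
Context {C : monoidal_category} (D : dual_data C).
Implicit Types X Y Z : C.

Definition curry X Y (f : hom (Y ⊗ X) (dual_base D)) : hom Y (dual D X) :=
  projT1 (cid (dual_rep f)).

Lemma curryK X Y (f : hom (Y ⊗ X) (dual_base D)) :
  dual_ev D X ∘ (curry f ⊠ idm X) = f.
Proof. by rewrite /curry; case: cid => /= phi []. Qed.

Lemma curry_uniq X Y (f : hom (Y ⊗ X) (dual_base D)) phi :
  dual_ev D X ∘ (phi ⊠ idm X) = f -> curry f = phi.
Proof. by rewrite /curry; case: cid => /= psi [_ U]; exact: U. Qed.

Definition dual_map X Y (f : hom X Y) : hom (dual D Y) (dual D X) :=
  curry (dual_ev D Y ∘ (idm (dual D Y) ⊠ f)).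

Lemma dual_mapP X Y (f : hom X Y) :
  dual_ev D X ∘ (dual_map f ⊠ idm X) = dual_ev D Y ∘ (idm (dual D Y) ⊠ f).
Proof. exact: curryK. Qed.

Lemma dual_map_id X : dual_map (idm X) = idm (dual D X).
Proof. exact: curry_uniq. Qed.

Lemma dual_map_comp X Y Z (g : hom Y Z) (f : hom X Y) :
  dual_map (g ∘ f) = dual_map f ∘ dual_map g.
Proof.
apply: curry_uniq; rewrite tensm_compl comp_assoc dual_mapP -comp_assoc.
by rewrite -tensm_swap comp_assoc dual_mapP -comp_assoc -tensm_compr.
Qed.

Definition dual_functor : functor (opposite C) C :=
  @Functor (opposite C) C (dual D) (fun X Y f => dual_map f) dual_map_id
    (fun X Y Z g f => dual_map_comp f g).

Lemma curry_comp X Y Y' (f : hom (Y ⊗ X) (dual_base D)) (g : hom Y' Y) :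
  curry (f ∘ (g ⊠ idm X)) = curry f ∘ g.
Proof. by apply: curry_uniq; rewrite tensm_compl comp_assoc curryK. Qed.

Lemma curry_ev X Y (phi : hom Y (dual D X)) :
  curry (dual_ev D X ∘ (phi ⊠ idm X)) = phi.
Proof. exact: curry_uniq. Qed.
End Dual.

Record dualizing_object (C : monoidal_category) := DualizingObject {
  dualizing_data :> dual_data C;
  dualizing_equiv : is_equivalence (dual_functor dualizing_data) }.

Record ribbon_twist (C : braided_category) (D : dualizing_object C) :=
  RibbonTwist {
  twist :> nat_iso (id_functor C) (id_functor C);
  twist_tens : forall X Y : C,
    twist (X ⊗ Y) = braid Y X ∘ braid X Y ∘ (twist X ⊠ twist Y);
  twist_dual : forall X : C, dual_map D (twist X) = twist (dual D X) }.

Record ribbon_GV_category (k : fieldType) := RibbonGVCategory {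
  rgv_lfa : locally_finite_abelian_category k;
  rgv_monoidal : monoidal_struct rgv_lfa;
  rgv_tens_linear_l : forall (X X' Y Y' : rgv_lfa) (a : k)
      (f f' : hom X X') (g : hom Y Y'),
    ms_map rgv_monoidal (addm (scalem a f) f') g =
    addm (scalem a (ms_map rgv_monoidal f g)) (ms_map rgv_monoidal f' g);
  rgv_tens_linear_r : forall (X X' Y Y' : rgv_lfa) (a : k)
      (f : hom X X') (g g' : hom Y Y'),
    ms_map rgv_monoidal f (addm (scalem a g) g') =
    addm (scalem a (ms_map rgv_monoidal f g)) (ms_map rgv_monoidal f g');
  rgv_braiding : braiding (MonoidalCategory rgv_monoidal);
  rgv_dualizing : dualizing_object (MonoidalCategory rgv_monoidal);
  rgv_twist : @ribbon_twist (BraidedCategory rgv_braiding) rgv_dualizing }.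

(* What is needed of a braided category for the relative tensor product of
   modules over a commutative algebra to be a monoidal structure. An abelian
   Grothendieck-Verdier category provides it ([coeq_of_ribbon_GV]): there
   [- ⊗ Z] has a right adjoint, [T |-> D (Z ⊗ W)] for [T] isomorphic to
   [D W]. *)
Record coeq_braided_category := CoeqBraidedCategory {
  coeq_braided :> braided_category;
  coeq_exists : forall (X Y : coeq_braided) (f g : hom X Y),
    exists Q (q : hom Y Q), is_coequalizer f g q;
  coeq_tens : forall (X Y Q Z : coeq_braided) (f g : hom X Y) (q : hom Y Q),
    is_coequalizer f g q ->
    is_coequalizer (f ⊠ idm Z) (g ⊠ idm Z) (q ⊠ idm Z) }.

Lemma abelian_coequalizer k (C : linear_category k) (X Y : C) (f g : hom X Y) :
  is_abelian C -> exists Q (q : hom Y Q), is_coequalizer f g q.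
Proof.
move=> Cab.
have subE Z (h : hom Y Z) :
    h ∘ addm (scalem (-1) g) f = zerom X Z <-> h ∘ f = h ∘ g.
  have -> : h ∘ addm (scalem (-1) g) f = addm (scalem (-1) (h ∘ g)) (h ∘ f).
    exact: lin_comp_linear_l.
  rewrite /addm /scalem /zerom scaleN1r addrC.
  split=> [/eqP|->]; last by rewrite subrr.
  by rewrite subr_eq0 => /eqP.
have [Q [q [qE qU]]] := abelian_cokernel Cab (addm (scalem (-1) g) f).
exists Q, q; split=> [|Z h hE]; first exact/subE.
by apply: qU; apply/subE.
Qed.

Lemma dualizing_coeq_tens (C : monoidal_category) (D : dualizing_object C)
    (X Y Q Z : C) (f g : hom X Y) (q : hom Y Q) :
  is_coequalizer f g q ->
  is_coequalizer (f ⊠ idm Z) (g ⊠ idm Z) (q ⊠ idm Z).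
Proof.
move=> [qE qU]; split=> [|T h hE]; first by rewrite -!tensm_compl qE.
have [G [_ [s]]] := dualizing_equiv D.
pose W : C := G T; have [j' [j'K jK]] := nat_map_iso s T.
set j : hom (dual D W) T := s T in j'K jK.
change (hom T (dual D W)) in (type of j').
have {}j'K : j' ∘ j = idm (dual D W) by [].
pose Phi (V : C) (u : hom (V ⊗ Z) T) : hom V (dual D (Z ⊗ W)) :=
  curry (dual_ev D W ∘ ((j' ∘ u) ⊠ idm W) ∘ assoc' V Z W).
pose Psi (V : C) (v : hom V (dual D (Z ⊗ W))) : hom (V ⊗ Z) T :=
  j ∘ curry (dual_ev D (Z ⊗ W) ∘ (v ⊠ idm (Z ⊗ W)) ∘ assoc V Z W).
have PhiK V u : Psi V (Phi V u) = u.
  rewrite /Psi /Phi comp_assoc curryK -!comp_assoc assocK comp_id_r curry_ev.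
  by rewrite comp_assoc jK comp_id_l.
have PsiK V v : Phi V (Psi V v) = v.
  rewrite /Psi /Phi (comp_eq _ j'K) comp_id_l comp_assoc curryK -!comp_assoc.
  by rewrite assoc'K comp_id_r curry_ev.
have PhiN V V' u (a : hom V' V) : Phi V' (u ∘ (a ⊠ idm Z)) = Phi V u ∘ a.
  rewrite /Phi -curry_comp; congr curry; rewrite -!comp_assoc; congr (_ ∘ _).
  rewrite -(tensm_id Z W) assoc'_nat (comp_eq _ (esym (tensm_compl _ _ _))).
  by rewrite -comp_assoc.
have PsiN V V' v (a : hom V' V) : Psi V' (v ∘ a) = Psi V v ∘ (a ⊠ idm Z).
  rewrite /Psi -comp_assoc -curry_comp; congr (_ ∘ curry _).
  by rewrite tensm_compl -!comp_assoc assoc_nat tensm_id.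
have [|u [uE uU]] := qU _ (Phi _ h); first by rewrite -!PhiN hE.
exists (Psi _ u); split=> [|v vE]; first by rewrite -PsiN uE PhiK.
by rewrite -(PhiK _ v); congr Psi; apply: uU; rewrite -PhiN vE.
Qed.

Section CoeqOfRibbonGV.
Variables (k : fieldType) (C : ribbon_GV_category k).

Definition coeq_of_ribbon_GV : coeq_braided_category :=
  @CoeqBraidedCategory (BraidedCategory (rgv_braiding C))
    (fun X Y f g => abelian_coequalizer f g (lfa_abelian (rgv_lfa C)))
    (fun X Y Q Z f g q => @dualizing_coeq_tens _ (rgv_dualizing C)
                             X Y Q Z f g q).
End CoeqOfRibbonGV.
Coercion coeq_of_ribbon_GV : ribbon_GV_category >-> coeq_braided_category.

Record algebra (C : monoidal_category) := Algebra {
  alg_ob :> C;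
  alg_mul : hom (alg_ob ⊗ alg_ob) alg_ob;
  alg_one : hom munit alg_ob;
  alg_mulA : alg_mul ∘ (alg_mul ⊠ idm alg_ob) =
    alg_mul ∘ (idm alg_ob ⊠ alg_mul) ∘ assoc alg_ob alg_ob alg_ob;
  alg_mul1l : alg_mul ∘ (alg_one ⊠ idm alg_ob) = lunit alg_ob;
  alg_mul1r : alg_mul ∘ (idm alg_ob ⊠ alg_one) = runit alg_ob }.

Record comm_algebra (C : braided_category) := CommAlgebra {
  comm_alg :> algebra C;
  alg_mulC : alg_mul comm_alg ∘ braid comm_alg comm_alg = alg_mul comm_alg }.

Record lmodule (C : monoidal_category) (A : algebra C) := LModule {
  mod_ob :> C;
  act : hom (A ⊗ mod_ob) mod_ob;
  act_mul : act ∘ (alg_mul A ⊠ idm mod_ob) =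
    act ∘ (idm A ⊠ act) ∘ assoc A A mod_ob;
  act_one : act ∘ (alg_one A ⊠ idm mod_ob) = lunit mod_ob }.

Record module_hom (C : monoidal_category) (A : algebra C) (M N : lmodule A) :=
  ModuleHom {
    mod_map :> hom (M : C) (N : C);
    mod_map_act : mod_map ∘ act M = act N ∘ (idm (A : C) ⊠ mod_map) }.

Section ModuleCategory.
Context {C : monoidal_category} (A : algebra C).
Implicit Types M N P : lmodule A.

Lemma module_hom_eq M N (f g : module_hom M N) :
  mod_map f = mod_map g -> f = g.
Proof.
case: f g => [f fP] [g gP] /= fg; case: _ / fg gP => gP.
by congr ModuleHom; apply: Prop_irrelevance.
Qed.

Fact module_id_act M : idm (M : C) ∘ act M = act M ∘ (idm (A : C) ⊠ idm (M : C)).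
Proof. by rewrite tensm_id comp_id_l comp_id_r. Qed.

Fact module_comp_act M N P (g : module_hom N P) (f : module_hom M N) :
  (mod_map g ∘ mod_map f) ∘ act M =
  act P ∘ (idm (A : C) ⊠ (mod_map g ∘ mod_map f)).
Proof.
rewrite -comp_assoc mod_map_act comp_assoc mod_map_act -comp_assoc.
by rewrite -tensm_compr.
Qed.

Definition module_struct : category_struct (@module_hom C A).
Proof.
exists (fun M => ModuleHom (module_id_act M))
       (fun M N P g f => ModuleHom (module_comp_act g f)) => *;
apply: module_hom_eq => /=.
- exact: comp_id_l.
- exact: comp_id_r.
- exact: comp_assoc.
Defined.

Definition module_category : category := Category module_struct.
End ModuleCategory.

Section RelativeTensor.
Context {C : coeq_braided_category} (A : comm_algebra C).
Implicit Types M N P : lmodule A.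
Local Notation a := (alg_ob (comm_alg A)).

Definition tensA_l M N : hom ((A ⊗ M) ⊗ N) (M ⊗ N) := act M ⊠ idm (N : C).
Definition tensA_r M N : hom ((A ⊗ M) ⊗ N) (M ⊗ N) :=
  (idm (M : C) ⊠ act N) ∘ assoc (M : C) A N ∘
  (braid (A : C) M ⊠ idm (N : C)).

Definition tensA_ob M N : C :=
  projT1 (cid (coeq_exists (tensA_l M N) (tensA_r M N))).
Definition tensA_proj M N : hom ((M : C) ⊗ N) (tensA_ob M N) :=
  projT1 (cid (projT2 (cid (coeq_exists (tensA_l M N) (tensA_r M N))))).

Lemma tensA_projP M N :
  is_coequalizer (tensA_l M N) (tensA_r M N) (tensA_proj M N).
Proof. exact: (projT2 (cid (projT2 (cid (coeq_exists _ _))))). Qed.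

(* The right action on a left module induced by the inverse braiding. With it
   the relative tensor product is the usual one of bimodules: precomposing
   [tensA_l] and [tensA_r] with the inverse braiding gives the pair of maps in
   [tensA_coequalizer]. It is locked to keep it from unfolding in rewrites. *)
Definition ract M : hom ((M : C) ⊗ A) M := locked (act M ∘ braid' (A : C) M).

Lemma ractE M : ract M = act M ∘ braid' (A : C) M. Proof. by rewrite /ract -lock. Qed.

Lemma ract_hom M N (f : module_hom M N) :
  ract N ∘ (mod_map f ⊠ idm a) = mod_map f ∘ ract M.
Proof.
by rewrite !ractE -comp_assoc braid'_nat !comp_assoc mod_map_act.
Qed.

Lemma tensA_proj_ract M N :
  tensA_proj M N ∘ (ract M ⊠ idm (N : C)) =
  tensA_proj M N ∘ (idm (M : C) ⊠ act N) ∘ assoc (M : C) A N.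
Proof.
have [E _] := tensA_projP M N.
rewrite ractE tensm_compl comp_assoc E /tensA_r -!comp_assoc -tensm_compl braid'K.
by rewrite tensm_id comp_id_r.
Qed.

Lemma tensA_coequalizer M N :
  is_coequalizer (ract M ⊠ idm (N : C))
    ((idm (M : C) ⊠ act N) ∘ assoc (M : C) A N) (tensA_proj M N).
Proof.
split=> [|Z h hE]; first exact: tensA_proj_ract.
apply: (tensA_projP M N).2; rewrite /tensA_l /tensA_r.
rewrite (comp_assoc (idm (M : C) ⊠ act N)) comp_assoc -hE -comp_assoc.
by rewrite -tensm_compl ractE -comp_assoc braidK comp_id_r.
Qed.

Lemma coeq_tens_l (X Y Q Z : C) (f g : hom X Y) (q : hom Y Q) :
  is_coequalizer f g q ->
  is_coequalizer (idm Z ⊠ f) (idm Z ⊠ g) (idm Z ⊠ q).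
Proof.
move=> qC; have [qE qU] := coeq_tens Z qC.
split=> [|T h hE]; first by rewrite -!tensm_compr qC.1.
have [|u [uE uU]] := qU T (h ∘ braid Y Z).
  by rewrite -!comp_assoc !braid_nat !comp_assoc hE.
exists (u ∘ braid' Q Z); split=> [|v vE].
  by rewrite -comp_assoc braid'_nat comp_assoc uE -comp_assoc braid'K comp_id_r.
rewrite (uU (v ∘ braid Q Z)) -?comp_assoc ?braid'K ?comp_id_r //.
by rewrite braid_nat comp_assoc vE.
Qed.

Lemma tensA_proj_epi M N : is_epi (tensA_proj M N).
Proof. exact: coequalizer_epi (tensA_coequalizer M N). Qed.

Lemma epi_proj_l M N Z : is_epi (idm Z ⊠ tensA_proj M N).
Proof. exact: coequalizer_epi (coeq_tens_l Z (tensA_coequalizer M N)). Qed.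

Lemma epi_proj_r M N Z : is_epi (tensA_proj M N ⊠ idm Z).
Proof. exact: coequalizer_epi (coeq_tens Z (tensA_coequalizer M N)). Qed.

Lemma mul_braid' : alg_mul A ∘ braid' (A : C) A = alg_mul A.
Proof. by rewrite -{1}(alg_mulC A) -comp_assoc braid'K comp_id_r. Qed.

Lemma act_braid' M :
  act M ∘ (idm a ⊠ act M) ∘ assoc (A : C) A M ∘ (braid' (A : C) A ⊠ idm (M : C))
    ∘ assoc' (A : C) A M = act M ∘ (idm a ⊠ act M).
Proof.
rewrite (comp_eq3 _ (esym (act_mul M))) -comp_assoc.
rewrite (comp_eq _ (esym (tensm_compl _ _ _))) mul_braid'.
by rewrite comp_assoc act_mul -!comp_assoc assoc'K comp_id_r.
Qed.

Lemma bimodule M :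
  ract M ∘ (act M ⊠ idm a) = act M ∘ (idm a ⊠ ract M) ∘ assoc (A : C) M A.
Proof.
rewrite !ractE -comp_assoc braid'_nat braid'_tensr tensm_compr.
have := congr1 (fun t => t ∘ (idm a ⊠ braid' (A : C) M) ∘ assoc (A : C) M A)
  (act_braid' M).
by rewrite -!comp_assoc.
Qed.

Lemma ract_mul M :
  ract M ∘ (ract M ⊠ idm a) =
  ract M ∘ (idm (M : C) ⊠ alg_mul A) ∘ assoc (M : C) A A.
Proof.
rewrite {2}ractE tensm_compl comp_assoc bimodule -!comp_assoc.
rewrite ractE -comp_assoc (comp_eq2 _ (braid'_nat _ _)) braid'_tensl.
rewrite tensm_compr -!comp_assoc (comp_eq _ (act_mul M)) -!comp_assoc.
by rewrite (comp_eq _ (assoc'K _ _ _)) comp_id_l assocK comp_id_r.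
Qed.

Lemma ract_one M : ract M ∘ (idm (M : C) ⊠ alg_one A) = runit (M : C).
Proof.
rewrite !ractE -comp_assoc braid'_nat comp_assoc act_one.
by rewrite -(runit_braid (M : C)) -comp_assoc braid'K comp_id_r.
Qed.

Lemma tensA_act_exists M N : exists! u : hom (A ⊗ tensA_ob M N) (tensA_ob M N),
  u ∘ (idm a ⊠ tensA_proj M N) =
  tensA_proj M N ∘ (act M ⊠ idm (N : C)) ∘ assoc' (A : C) M N.
Proof.
apply: (coeq_tens_l (A : C) (tensA_coequalizer M N)).2.
rewrite -!comp_assoc assoc'_nat.
rewrite (comp_eq _ (esym (tensm_compl _ _ _))).
have -> : act M ∘ (idm a ⊠ ract M) =
    ract M ∘ (act M ⊠ idm a) ∘ assoc' (A : C) M A.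
  by rewrite comp_assoc bimodule -!comp_assoc assoc'K comp_id_r.
rewrite !tensm_compl -!comp_assoc (comp_eq _ (tensA_proj_ract M N)) -!comp_assoc.
rewrite (comp_eq2 _ (assoc_nat _ _ _)) tensm_id.
rewrite tensm_compr (comp_eq2 _ (assoc'_nat _ _ _)) tensm_id.
rewrite (comp_eq2 _ (tensm_swap _ _)); do 3!congr (_ ∘ _).
exact: pentagon_l.
Qed.

Definition tensA_act M N : hom (A ⊗ tensA_ob M N) (tensA_ob M N) :=
  projT1 (cid (tensA_act_exists M N)).

Lemma tensA_actP M N :
  tensA_act M N ∘ (idm a ⊠ tensA_proj M N) =
  tensA_proj M N ∘ (act M ⊠ idm (N : C)) ∘ assoc' (A : C) M N.
Proof. by rewrite /tensA_act; case: cid => /= u []. Qed.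

Lemma tensA_act_mul M N :
  tensA_act M N ∘ (alg_mul A ⊠ idm (tensA_ob M N)) =
  tensA_act M N ∘ (idm a ⊠ tensA_act M N) ∘ assoc a a (tensA_ob M N).
Proof.
apply: (@epi_proj_l M N (a ⊗ a)); rewrite -!comp_assoc.
rewrite tensm_swap (comp_eq _ (tensA_actP M N)) -!comp_assoc.
rewrite -(tensm_id (M : C) (N : C)) assoc'_nat.
rewrite (comp_eq _ (esym (tensm_compl _ _ _))) act_mul.
rewrite -(tensm_id a a) assoc_nat (comp_eq _ (esym (tensm_compr _ _ _))).
rewrite tensA_actP !tensm_compr !tensm_compl -!comp_assoc.
rewrite (comp_eq _ (tensA_actP M N)) -!comp_assoc.
rewrite (comp_eq2 _ (assoc'_nat _ _ _)).
by rewrite pentagon_r.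
Qed.

Lemma tensA_act_one M N :
  tensA_act M N ∘ (alg_one A ⊠ idm (tensA_ob M N)) = lunit (tensA_ob M N).
Proof.
apply: (@epi_proj_l M N munit); rewrite -!comp_assoc.
rewrite tensm_swap (comp_eq _ (tensA_actP M N)) -!comp_assoc.
rewrite -(tensm_id (M : C) (N : C)) assoc'_nat.
rewrite (comp_eq _ (esym (tensm_compl _ _ _))) act_one lunit_nat.
by rewrite -lunit_assoc -comp_assoc assoc'K comp_id_r.
Qed.

Definition tensA M N : lmodule A := LModule (tensA_act_mul M N) (tensA_act_one M N).

Lemma ract_tensA M N :
  ract (tensA M N) ∘ (tensA_proj M N ⊠ idm a) =
  tensA_proj M N ∘ (idm (M : C) ⊠ ract N) ∘ assoc (M : C) N a.
Proof.
rewrite ractE -comp_assoc braid'_nat (comp_eq _ (tensA_actP M N)) -!comp_assoc.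
rewrite braid'_tensr (comp_eq _ (assocK _ _ _)) comp_id_l.
rewrite (comp_eq _ (esym (tensm_compl _ _ _))) -ractE.
rewrite (comp_eq _ (tensA_proj_ract M N)) -!comp_assoc.
rewrite (comp_eq _ (assoc'K _ _ _)) comp_id_l.
by rewrite (comp_eq _ (esym (tensm_compr _ _ _))) -ractE.
Qed.

Lemma tensA_lift_exists M N P (h : hom ((M : C) ⊗ N) P) :
  h ∘ (ract M ⊠ idm (N : C)) = h ∘ (idm (M : C) ⊠ act N) ∘ assoc (M : C) a N ->
  h ∘ (act M ⊠ idm (N : C)) = act P ∘ (idm a ⊠ h) ∘ assoc a M N ->
  exists f : module_hom (tensA M N) P, mod_map f ∘ tensA_proj M N = h.
Proof.
move=> hb hl; have [u [uE _]] := (tensA_coequalizer M N).2 _ h hb.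
suff uP : u ∘ act (tensA M N) = act P ∘ (idm a ⊠ u) by exists (ModuleHom uP).
apply: (@epi_proj_l M N a); rewrite -!comp_assoc tensA_actP (comp_eq _ uE).
rewrite -tensm_compr uE comp_assoc hl -!comp_assoc assoc'K comp_id_r.
by [].
Qed.

Definition tensA_lift M N P (h : hom ((M : C) ⊗ N) P) hb hl :
  module_hom (tensA M N) P := projT1 (cid (@tensA_lift_exists M N P h hb hl)).

Lemma tensA_liftP M N P (h : hom ((M : C) ⊗ N) P) hb hl :
  mod_map (@tensA_lift M N P h hb hl) ∘ tensA_proj M N = h.
Proof. exact: (projT2 (cid (tensA_lift_exists _ _))). Qed.

Section TensAMap.
Variables (M M' N N' : lmodule A) (f : module_hom M M') (g : module_hom N N').

Fact tensA_map_balanced :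
  (tensA_proj M' N' ∘ (mod_map f ⊠ mod_map g)) ∘ (ract M ⊠ idm (N : C)) =
  (tensA_proj M' N' ∘ (mod_map f ⊠ mod_map g)) ∘ (idm (M : C) ⊠ act N) ∘
    assoc (M : C) a N.
Proof.
rewrite -!comp_assoc -tensm_comp comp_id_r -ract_hom.
rewrite (comp_eq _ (esym (tensm_comp _ _ _ _))) comp_id_r mod_map_act.
rewrite -{1}(comp_id_l (mod_map g)) tensm_comp.
rewrite (comp_eq _ (tensA_proj_ract M' N')) -!comp_assoc assoc_nat.
by rewrite (comp_eq _ (esym (tensm_comp _ _ _ _))) comp_id_l.
Qed.

Fact tensA_map_linear :
  (tensA_proj M' N' ∘ (mod_map f ⊠ mod_map g)) ∘ (act M ⊠ idm (N : C)) =
  act (tensA M' N') ∘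
    (idm a ⊠ (tensA_proj M' N' ∘ (mod_map f ⊠ mod_map g))) ∘ assoc a M N.
Proof.
rewrite tensm_compr -!comp_assoc [RHS](comp_eq _ (tensA_actP M' N')) -!comp_assoc.
rewrite (comp_eq2 _ (assoc'_nat _ _ _)) assocK comp_id_r.
by rewrite -!tensm_comp comp_id_r comp_id_l mod_map_act.
Qed.

Definition tensA_map : module_hom (tensA M N) (tensA M' N') :=
  @tensA_lift M N (tensA M' N') _ tensA_map_balanced tensA_map_linear.

Lemma tensA_mapP :
  mod_map tensA_map ∘ tensA_proj M N =
  tensA_proj M' N' ∘ (mod_map f ⊠ mod_map g).
Proof. exact: tensA_liftP. Qed.
End TensAMap.

Lemma module_inv M N (f : module_hom M N) (g : hom (N : C) M) :
  g ∘ mod_map f = idm (M : C) -> mod_map f ∘ g = idm (N : C) ->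
  g ∘ act N = act M ∘ (idm a ⊠ g).
Proof.
move=> gf fg; rewrite -[LHS]comp_id_r -tensm_id -fg tensm_compr -!comp_assoc.
by rewrite (comp_eq2 _ (esym (mod_map_act f))) (comp_eq _ gf) comp_id_l.
Qed.

Definition unitA : lmodule A :=
  @LModule C A A (alg_mul A) (alg_mulA A) (alg_mul1l A).

Lemma ract_unitA : ract unitA = alg_mul A.
Proof. by rewrite ractE /= mul_braid'. Qed.

Section Units.
Variable M : lmodule A.

Fact lunitA_balanced :
  act M ∘ (ract unitA ⊠ idm (M : C)) = act M ∘ (idm a ⊠ act M) ∘ assoc a a M.
Proof. by rewrite ract_unitA act_mul. Qed.

Definition lunitA : module_hom (tensA unitA M) M :=
  @tensA_lift unitA M M (act M) lunitA_balanced (act_mul M).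

Lemma lunitAP : mod_map lunitA ∘ tensA_proj unitA M = act M.
Proof. exact: tensA_liftP. Qed.

Definition lunitA'_map : hom (M : C) (tensA unitA M) :=
  tensA_proj unitA M ∘ (alg_one A ⊠ idm (M : C)) ∘ lunit' (M : C).

Fact lunitA'K : mod_map lunitA ∘ lunitA'_map = idm (M : C).
Proof.
by rewrite /lunitA'_map (comp_eq _ lunitAP) comp_assoc act_one lunit'K.
Qed.

Fact lunitAK : lunitA'_map ∘ mod_map lunitA = idm (tensA unitA M : C).
Proof.
apply: (@tensA_proj_epi unitA M); rewrite -comp_assoc lunitAP comp_id_l.
rewrite /lunitA'_map -!comp_assoc lunit'_nat.
rewrite (comp_eq2 _ (tensm_swap _ _)).
have E : tensA_proj unitA M ∘ (idm a ⊠ act M) =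
    tensA_proj unitA M ∘ (alg_mul A ⊠ idm (M : C)) ∘ assoc' a a M.
  rewrite -ract_unitA [RHS](comp_eq _ (tensA_proj_ract _ _)).
  by rewrite -!comp_assoc assoc'K comp_id_r.
rewrite (comp_eq _ E) -!comp_assoc -(tensm_id a (M : C)).
rewrite (comp_eq2 _ (assoc'_nat _ _ _)).
rewrite (comp_eq _ (esym (tensm_compl _ _ _))) alg_mul1l -lunit_assoc.
by rewrite -comp_assoc (comp_eq _ (assoc'K _ _ _)) comp_id_l lunit'K comp_id_r.
Qed.

Definition lunitA' : module_hom M (tensA unitA M) :=
  ModuleHom (module_inv lunitAK lunitA'K).

Fact runitA_linear :
  ract M ∘ (act M ⊠ idm a) = act M ∘ (idm a ⊠ ract M) ∘ assoc a M a.
Proof. exact: bimodule. Qed.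

Definition runitA : module_hom (tensA M unitA) M :=
  @tensA_lift M unitA M (ract M) (ract_mul M) runitA_linear.

Lemma runitAP : mod_map runitA ∘ tensA_proj M unitA = ract M.
Proof. exact: tensA_liftP. Qed.

Definition runitA'_map : hom (M : C) (tensA M unitA) :=
  tensA_proj M unitA ∘ (idm (M : C) ⊠ alg_one A) ∘ runit' (M : C).

Fact runitA'K : mod_map runitA ∘ runitA'_map = idm (M : C).
Proof.
by rewrite /runitA'_map (comp_eq _ runitAP) comp_assoc ract_one runit'K.
Qed.

Fact runitAK : runitA'_map ∘ mod_map runitA = idm (tensA M unitA : C).
Proof.
apply: (@tensA_proj_epi M unitA); rewrite -comp_assoc runitAP comp_id_l.
rewrite /runitA'_map -!comp_assoc runit'_nat.
rewrite (comp_eq2 _ (esym (tensm_swap _ _))).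
rewrite (comp_eq _ (tensA_proj_ract _ _)) -!comp_assoc -(tensm_id (M : C) a).
rewrite (comp_eq2 _ (assoc_nat _ _ _)).
rewrite (comp_eq _ (esym (tensm_compr _ _ _))) alg_mul1r.
by rewrite (comp_eq _ (runit_assoc _ _)) runit'K comp_id_r.
Qed.

Definition runitA' : module_hom M (tensA M unitA) :=
  ModuleHom (module_inv runitAK runitA'K).
End Units.

Lemma epi_proj_rr M N Z W : is_epi ((tensA_proj M N ⊠ idm Z) ⊠ idm W).
Proof.
exact: coequalizer_epi (coeq_tens W (coeq_tens Z (tensA_coequalizer M N))).
Qed.

Lemma epi_proj_lr M N Z W : is_epi ((idm Z ⊠ tensA_proj M N) ⊠ idm W).
Proof.
exact: coequalizer_epi (coeq_tens W (coeq_tens_l Z (tensA_coequalizer M N))).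
Qed.

Lemma tensA_lift3 M N P (T : lmodule A) (h : hom (((M : C) ⊗ N) ⊗ P) T) :
  h ∘ ((ract M ⊠ idm (N : C)) ⊠ idm (P : C)) =
    h ∘ ((idm (M : C) ⊠ act N) ⊠ idm (P : C)) ∘
      (assoc (M : C) a N ⊠ idm (P : C)) ->
  h ∘ ((idm (M : C) ⊠ ract N) ⊠ idm (P : C)) ∘
      (assoc (M : C) N a ⊠ idm (P : C)) =
    h ∘ (idm ((M : C) ⊗ N) ⊠ act P) ∘ assoc ((M : C) ⊗ N) a P ->
  h ∘ ((act M ⊠ idm (N : C)) ⊠ idm (P : C)) =
    act T ∘ (idm a ⊠ h) ∘ assoc a ((M : C) ⊗ N) P ∘
      (assoc a M N ⊠ idm (P : C)) ->
  exists f : module_hom (tensA (tensA M N) P) T,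
    mod_map f ∘ tensA_proj (tensA M N) P ∘ (tensA_proj M N ⊠ idm (P : C)) = h.
Proof.
move=> hb1 hb2 hl.
have [|u [uE _]] := (coeq_tens (P : C) (tensA_coequalizer M N)).2 _ h.
  by rewrite tensm_compl.
have [||f fE] := @tensA_lift_exists (tensA M N) P T u; last first.
- by exists f; rewrite comp_assoc fE.
- apply: (@epi_proj_lr M N a (P : C)); rewrite -!comp_assoc.
  rewrite -tensm_compl tensA_actP assoc_nat (comp_eq _ (esym (tensm_compr _ _ _))).
  rewrite uE !tensm_compl (comp_eq _ uE) (comp_eq2 _ hl) -!comp_assoc.
  by rewrite -tensm_compl assoc'K tensm_id comp_id_r.
apply: (@epi_proj_rr M N a (P : C)); rewrite -!comp_assoc.
rewrite -tensm_compl ract_tensA assoc_nat tensm_id.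
rewrite (comp_eq2 _ (esym (tensm_swap _ _))) (comp_eq _ uE) -hb2.
by rewrite !tensm_compl (comp_eq _ uE).
Qed.

Lemma tensA_lift3' M N P (T : lmodule A) (h : hom ((M : C) ⊗ ((N : C) ⊗ P)) T) :
  h ∘ (ract M ⊠ idm ((N : C) ⊗ P)) =
    h ∘ (idm (M : C) ⊠ (act N ⊠ idm (P : C))) ∘
      (idm (M : C) ⊠ assoc' a N P) ∘ assoc (M : C) a ((N : C) ⊗ P) ->
  h ∘ (idm (M : C) ⊠ (ract N ⊠ idm (P : C))) =
    h ∘ (idm (M : C) ⊠ (idm (N : C) ⊠ act P)) ∘
      (idm (M : C) ⊠ assoc (N : C) a P) ->
  h ∘ (act M ⊠ idm ((N : C) ⊗ P)) =
    act T ∘ (idm a ⊠ h) ∘ assoc a M ((N : C) ⊗ P) ->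
  exists f : module_hom (tensA M (tensA N P)) T,
    mod_map f ∘ tensA_proj M (tensA N P) ∘ (idm (M : C) ⊠ tensA_proj N P) = h.
Proof.
move=> hb1 hb2 hl.
have [|u [uE _]] := (coeq_tens_l (M : C) (tensA_coequalizer N P)).2 _ h.
  by rewrite tensm_compr.
have [||f fE] := @tensA_lift_exists M (tensA N P) T u; last first.
- by exists f; rewrite comp_assoc fE.
- apply: (@epi_proj_l N P (a ⊗ M)); rewrite -!comp_assoc.
  rewrite tensm_swap (comp_eq _ uE) -(tensm_id a (M : C)) assoc_nat.
  by rewrite (comp_eq _ (esym (tensm_compr _ _ _))) uE.
apply: (@epi_proj_l N P ((M : C) ⊗ a)); rewrite -!comp_assoc.
rewrite tensm_swap (comp_eq _ uE) -(tensm_id (M : C) a) assoc_nat.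
rewrite (comp_eq _ (esym (tensm_compr _ _ _))) tensA_actP hb1.
by rewrite !tensm_compr -!comp_assoc (comp_eq _ uE).
Qed.

Lemma assocA_exists M N P :
  exists f : module_hom (tensA (tensA M N) P) (tensA M (tensA N P)),
    mod_map f ∘ tensA_proj (tensA M N) P ∘ (tensA_proj M N ⊠ idm (P : C)) =
    tensA_proj M (tensA N P) ∘ (idm (M : C) ⊠ tensA_proj N P) ∘
      assoc (M : C) N P.
Proof.
apply: tensA_lift3; rewrite -!comp_assoc.
- rewrite !assoc_nat (comp_eq2 _ (assoc_nat _ _ _)) tensm_id.
  rewrite (comp_eq2 _ (esym (tensm_swap _ _))).
  rewrite (comp_eq _ (tensA_proj_ract _ _)) -!comp_assoc.
  rewrite -(tensm_id (M : C) a) (comp_eq2 _ (assoc_nat _ _ _)).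
  rewrite (comp_eq _ (esym (tensm_compr _ _ _))) tensA_actP !tensm_compr.
  rewrite -!comp_assoc -pentagon.
  by rewrite (comp_eq _ (esym (tensm_compr _ (assoc' _ _ _) _))) assocK tensm_id comp_id_l.
- rewrite (comp_eq2 _ (assoc_nat _ _ _)).
  rewrite (comp_eq _ (esym (tensm_compr _ _ _))) tensA_proj_ract !tensm_compr.
  rewrite -!comp_assoc pentagon -(tensm_id (M : C) (N : C)).
  by rewrite [in RHS](comp_eq2 _ (assoc_nat _ _ _)).
rewrite assoc_nat tensm_id (comp_eq2 _ (esym (tensm_swap _ _))).
rewrite !tensm_compr -!comp_assoc [RHS](comp_eq _ (tensA_actP _ _)) -!comp_assoc.
rewrite (comp_eq2 _ (assoc'_nat _ _ _)) pentagon.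
by rewrite (comp_eq _ (assocK _ _ _)) comp_id_l tensm_id.
Qed.

Lemma assocA'_exists M N P :
  exists f : module_hom (tensA M (tensA N P)) (tensA (tensA M N) P),
    mod_map f ∘ tensA_proj M (tensA N P) ∘ (idm (M : C) ⊠ tensA_proj N P) =
    tensA_proj (tensA M N) P ∘ (tensA_proj M N ⊠ idm (P : C)) ∘
      assoc' (M : C) N P.
Proof.
apply: tensA_lift3'; rewrite -!comp_assoc.
- rewrite -(tensm_id (N : C) (P : C)) assoc'_nat (comp_eq2 _ (assoc'_nat _ _ _)).
  rewrite (comp_eq _ (esym (tensm_compl _ _ _))) tensA_proj_ract !tensm_compl.
  by rewrite -!comp_assoc -pentagon_r.
- rewrite assoc'_nat (comp_eq2 _ (assoc'_nat _ _ _)) tensm_id.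
  rewrite (comp_eq2 _ (tensm_swap _ _)) -pentagon_l.
  have E : tensA_proj M N ∘ (idm (M : C) ⊠ ract N) =
      ract (tensA M N) ∘ (tensA_proj M N ⊠ idm a) ∘ assoc' (M : C) N a.
    by rewrite comp_assoc ract_tensA -!comp_assoc assoc'K comp_id_r.
  rewrite (comp_eq _ (esym (tensm_compl _ _ _))) E !tensm_compl -!comp_assoc.
  rewrite (comp_eq _ (tensA_proj_ract _ _)) -!comp_assoc.
  by rewrite (comp_eq2 _ (assoc_nat _ _ _)) tensm_id.
rewrite -(tensm_id (N : C) (P : C)) assoc'_nat.
have E : tensA_proj M N ∘ (act M ⊠ idm (N : C)) =
    act (tensA M N) ∘ (idm a ⊠ tensA_proj M N) ∘ assoc a M N.
  by rewrite comp_assoc tensA_actP -!comp_assoc assocK comp_id_r.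
rewrite (comp_eq _ (esym (tensm_compl _ _ _))) E !tensm_compl -!comp_assoc.
rewrite !tensm_compr -!comp_assoc [RHS](comp_eq _ (tensA_actP _ _)) -!comp_assoc.
by rewrite !(comp_eq2 _ (assoc'_nat _ _ _)) pentagon_r.
Qed.

(* The associator is determined by [assocAP], since the projections are epi. *)
Definition assocA M N P :
  module_hom (tensA (tensA M N) P) (tensA M (tensA N P)) :=
  projT1 (cid (assocA_exists M N P)).

Definition assocA' M N P :
  module_hom (tensA M (tensA N P)) (tensA (tensA M N) P) :=
  projT1 (cid (assocA'_exists M N P)).

Lemma assocAP M N P :
  mod_map (assocA M N P) ∘ tensA_proj (tensA M N) P ∘
    (tensA_proj M N ⊠ idm (P : C)) =
  tensA_proj M (tensA N P) ∘ (idm (M : C) ⊠ tensA_proj N P) ∘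
    assoc (M : C) N P.
Proof. exact: (projT2 (cid (assocA_exists M N P))). Qed.

Lemma assocA'P M N P :
  mod_map (assocA' M N P) ∘ tensA_proj M (tensA N P) ∘
    (idm (M : C) ⊠ tensA_proj N P) =
  tensA_proj (tensA M N) P ∘ (tensA_proj M N ⊠ idm (P : C)) ∘
    assoc' (M : C) N P.
Proof. exact: (projT2 (cid (assocA'_exists M N P))). Qed.

Lemma tensA_proj3_epi M N P :
  is_epi (tensA_proj (tensA M N) P ∘ (tensA_proj M N ⊠ idm (P : C))).
Proof. exact (is_epi_comp (@tensA_proj_epi (tensA M N) P) (@epi_proj_r M N P)). Qed.

Lemma tensA_proj3'_epi M N P :
  is_epi (tensA_proj M (tensA N P) ∘ (idm (M : C) ⊠ tensA_proj N P)).
Proof. exact (is_epi_comp (@tensA_proj_epi M (tensA N P)) (@epi_proj_l N P M)). Qed.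

Definition modules_struct : monoidal_struct (module_category A).
Proof.
apply: (@MonoidalStruct (module_category A) unitA tensA
  (fun M M' N N' f g => tensA_map f g) assocA assocA'
  lunitA lunitA' runitA runitA').
- move=> M N; apply: module_hom_eq; apply: (@tensA_proj_epi M N).
  by rewrite tensA_mapP /= tensm_id comp_id_l comp_id_r.
- move=> M M' M'' N N' N'' g f g' f'; apply: module_hom_eq => /=.
  apply: (@tensA_proj_epi M N); rewrite -comp_assoc !tensA_mapP /=.
  by rewrite (comp_eq _ (tensA_mapP _ _)) -comp_assoc tensm_comp.
- move=> M N P; apply: module_hom_eq => /=; apply: (@tensA_proj3_epi M N P).
  rewrite -comp_assoc assocAP (comp_eq3 _ (assocA'P _ _ _)) -!comp_assoc.
  by rewrite assocK comp_id_r comp_id_l.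
- move=> M N P; apply: module_hom_eq => /=; apply: (@tensA_proj3'_epi M N P).
  rewrite -comp_assoc assocA'P (comp_eq3 _ (assocAP _ _ _)) -!comp_assoc.
  by rewrite assoc'K comp_id_r comp_id_l.
- by move=> M; apply: module_hom_eq; apply: lunitAK.
- by move=> M; apply: module_hom_eq; apply: lunitA'K.
- by move=> M; apply: module_hom_eq; apply: runitAK.
- by move=> M; apply: module_hom_eq; apply: runitA'K.
- move=> M M' N N' P P' f g h; apply: module_hom_eq => /=.
  apply: (@tensA_proj3_epi M N P); rewrite -!comp_assoc assocAP.
  rewrite (comp_eq _ (tensA_mapP _ _)) -!comp_assoc -tensm_comp tensA_mapP.
  rewrite comp_id_r -(comp_id_l (mod_map h)) tensm_comp.
  rewrite (comp_eq3 _ (assocAP _ _ _)) -!comp_assoc assoc_nat.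
  rewrite (comp_eq _ (tensA_mapP _ _)) -!comp_assoc.
  rewrite !(comp_eq _ (esym (tensm_comp _ _ _ _))) tensA_mapP.
  by rewrite comp_id_l comp_id_r.
- move=> M N f; apply: module_hom_eq => /=; apply: (@tensA_proj_epi unitA M).
  rewrite -!comp_assoc tensA_mapP lunitAP (comp_eq _ (lunitAP _)).
  by rewrite mod_map_act.
- move=> M N f; apply: module_hom_eq => /=; apply: (@tensA_proj_epi M unitA).
  rewrite -!comp_assoc tensA_mapP runitAP (comp_eq _ (runitAP _)).
  by rewrite ract_hom.
- move=> M N P Q; apply: module_hom_eq => /=.
  apply: (@tensA_proj3_epi (tensA M N) P Q).
  apply: (@epi_proj_rr M N (P : C) (Q : C)); rewrite -!comp_assoc.
  rewrite (comp_eq _ (tensA_mapP _ _)) -!comp_assoc -!tensm_compl assocAP.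
  rewrite !tensm_compl (comp_eq3 _ (assocAP _ _ _)) -!comp_assoc.
  rewrite (comp_eq2 _ (assoc_nat _ _ _)) (comp_eq _ (tensA_mapP _ _)) -!comp_assoc.
  rewrite !(comp_eq _ (esym (tensm_compr _ _ _))) -!comp_assoc assocAP.
  rewrite (comp_eq3 _ (assocAP _ _ _)) -!comp_assoc assoc_nat tensm_id.
  rewrite (comp_eq2 _ (esym (tensm_swap _ _))).
  rewrite (comp_eq3 _ (assocAP _ _ _)) -!comp_assoc.
  rewrite -(tensm_id (M : C) (N : C)) (comp_eq2 _ (assoc_nat _ _ _)).
  by rewrite !tensm_compr -!comp_assoc pentagon.
- move=> M N; apply: module_hom_eq => /=; apply: (@tensA_proj3_epi M unitA N).
  rewrite -!comp_assoc assocAP !(comp_eq _ (tensA_mapP _ _)) -!comp_assoc.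
  rewrite -tensm_compl (comp_eq _ (esym (tensm_compr _ _ _))).
  by rewrite lunitAP runitAP tensA_proj_ract.
Defined.

Definition modules : monoidal_category := MonoidalCategory modules_struct.

Definition is_local M : Prop :=
  act M ∘ braid (M : C) a ∘ braid a (M : C) = act M.

Lemma is_localE M : is_local M <-> act M ∘ braid (M : C) a = ract M.
Proof.
rewrite /is_local ractE; split=> E.
  by rewrite -[in RHS]E -!comp_assoc braid'K comp_id_r.
by rewrite comp_assoc E -comp_assoc braidK comp_id_r.
Qed.

Lemma is_local_unit : is_local unitA.
Proof. by rewrite /is_local /= comp_assoc !alg_mulC. Qed.

Lemma is_local_tensA M N : is_local M -> is_local N -> is_local (tensA M N).
Proof.
move=> /is_localE Ml /is_localE Nl; apply/is_localE.
apply: (@epi_proj_r M N a); rewrite ract_tensA -!comp_assoc braid_nat.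
rewrite (comp_eq _ (tensA_actP _ _)) -!comp_assoc braid_tensl.
rewrite (comp_eq _ (assocK _ _ _)) comp_id_l.
rewrite (comp_eq _ (esym (tensm_compl _ _ _))) Ml.
rewrite (comp_eq _ (tensA_proj_ract _ _)) -!comp_assoc.
rewrite (comp_eq _ (assoc'K _ _ _)) comp_id_l.
by rewrite (comp_eq _ (esym (tensm_compr _ _ _))) Nl.
Qed.
End RelativeTensor.

Section FullMonoidal.
Variables (C : monoidal_category) (P : C -> Prop).
Hypotheses (P1 : P munit) (Ptens : forall X Y, P X -> P Y -> P (X ⊗ Y)).

Definition full_subcategory : category :=
  @Category {X : C | P X} (fun X Y => hom (sval X) (sval Y))
    (@CategoryStruct {X : C | P X} (fun X Y => hom (sval X) (sval Y))
      (fun X => idm (sval X)) (fun X Y Z g f => g ∘ f)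
      (fun X Y f => comp_id_l f) (fun X Y f => comp_id_r f)
      (fun X Y Z W h g f => comp_assoc h g f)).

Definition full_monoidal_struct : monoidal_struct full_subcategory.
Proof.
apply: (@MonoidalStruct full_subcategory (exist _ munit P1)
  (fun X Y => exist _ (sval X ⊗ sval Y) (Ptens (svalP X) (svalP Y)))
  (fun X X' Y Y' f g => tensm f g)
  (fun X Y Z => assoc (sval X) (sval Y) (sval Z))
  (fun X Y Z => assoc' (sval X) (sval Y) (sval Z))
  (fun X => lunit (sval X)) (fun X => lunit' (sval X))
  (fun X => runit (sval X)) (fun X => runit' (sval X))) => *.
- exact: tensm_id.
- exact: tensm_comp.
- exact: assocK.
- exact: assoc'K.
- exact: lunitK.
- exact: lunit'K.
- exact: runitK.
- exact: runit'K.
- exact: assoc_nat.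
- exact: lunit_nat.
- exact: runit_nat.
- exact: pentagon.
- exact: triangle.
Defined.

Definition full_monoidal : monoidal_category :=
  MonoidalCategory full_monoidal_struct.
End FullMonoidal.

Definition local_modules (C : coeq_braided_category) (A : comm_algebra C) :
    monoidal_category :=
  @full_monoidal (modules A) (@is_local C A) (@is_local_unit C A)
    (@is_local_tensA C A).

(* Main.v *)
From mathcomp Require Import all_boot all_algebra.
From mathcomp Require Import boolp.
Import GRing.Theory.
Require Import Defs.

(** Write [C] for the ambient category, [D] for its duality, [A] for the algebra
    and [E] for the category of [A]-modules. Simple [A]-modules are local, hence
    have duals, so the point is that having a dual passes from the ends of a
    short exact sequence [X' -> X -> X''] in [E] to its middle. The tensor
    product of [E] is only right exact; the exactness that is missing on the left
    is supplied by duality.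

    The duality of [C] lifts to modules: the dual [D N] of a module is again a
    module, and morphisms [T -> D N] of modules are the forms on the tensor
    product of [T] and [N] over [A] with values in the dualizing object
    ([balanced_left_pairing]). Hence [D (X ⊗ W)] is an internal hom from [X] to
    any [Z] that is paired with [W] ([pairing_internal_hom]), and every [Z] has
    such a partner [W]. An object [X] has a left dual iff the comparison
    [Z ⊗ Hom (X, A) -> Hom (X, Z)] is invertible for [Z = X], and then it is so
    for all [Z] ([comparison_iso_left_dual], [left_dual_comparison_iso]). As a
    functor of [X], the target [D (X ⊗ W)] sends a short exact sequence to a left
    exact one, since [D] is exact and [⊗] is right exact. The source
    [Z ⊗ D (X ⊗ W1)], where [W1] is a partner of the unit [A], sends it to a right
    exact one as soon as [- ⊗ W1] is exact. Then the five lemma, which for such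
    rows needs nothing at the outer ends, gives the comparison at [X] from those
    at [X'] and [X''] ([left_dual_extension]).

    Exactness of [- ⊗ W1] is where local modules enter: [W1] is the dual of [A]
    in [C], the hypothesis on the square of the twist of [A] makes it a local
    module ([is_local_right_partner]), and so it has duals by rigidity of
    the local modules. Right duals are left duals for the reversed tensor
    product, where the other dual module of [A] plays the part of [W1]. Induction
    on length ([module_devissage]) then reduces all modules to simple ones. *)

Set Implicit Arguments.
Unset Strict Implicit.
Unset Printing Implicit Defensive.

Local Open Scope cat_scope.

(** * Exact sequences in a linear abelian category *)

Section Exactness.
Context {k : fieldType} {C : linear_category k}.
Implicit Types X Y Z Q S T F G : C.

Lemma zerom_comp X Y Z (f : hom X Y) : zerom Y Z ∘ f = zerom X Z.
Proof.
have := @lin_comp_linear_r k C X Y Z f (-1)%R 0%R 0%R.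
by rewrite scaler0 addr0 scaleN1r addNr.
Qed.

Lemma comp_zerom X Y Z (f : hom Y Z) : f ∘ zerom X Y = zerom X Z.
Proof.
have := @lin_comp_linear_l k C X Y Z f (-1)%R 0%R 0%R.
by rewrite scaler0 addr0 scaleN1r addNr.
Qed.

Lemma mono_zero X Y (f : hom X Y) :
  (forall Z (u : hom Z X), f ∘ u = zerom Z Y -> u = zerom Z X) -> is_mono f.
Proof.
move=> fP Z u v E.
pose w := ((-1) *: (v : @lin_hom k C Z X) + u)%R.
have /fP : f ∘ (w : hom Z X) = zerom Z Y.
  have := @lin_comp_linear_l k C Z X Y f (-1)%R v u.
  by move: E; rewrite /comp /= => -> ->; rewrite scaleN1r addNr.
by rewrite /w scaleN1r addrC => /eqP; rewrite subr_eq0 => /eqP.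
Qed.

Lemma epi_zero X Y (f : hom X Y) :
  (forall Z (u : hom Y Z), u ∘ f = zerom X Z -> u = zerom Y Z) -> is_epi f.
Proof.
move=> fP Z u v E.
pose w := ((-1) *: (v : @lin_hom k C Y Z) + u)%R.
have /fP : (w : hom Y Z) ∘ f = zerom X Z.
  have := @lin_comp_linear_r k C X Y Z f (-1)%R v u.
  by move: E; rewrite /comp /= => -> ->; rewrite scaleN1r addNr.
by rewrite /w scaleN1r addrC => /eqP; rewrite subr_eq0 => /eqP.
Qed.

Lemma kernel_mono N X Y (i : hom N X) (f : hom X Y) : is_kernel i f -> is_mono i.
Proof.
move=> [fi iU] Z u v E; have [|w [_ wU]] := iU Z (i ∘ u).
  by rewrite comp_assoc fi zerom_comp.
by rewrite -(wU u erefl) (wU v (esym E)).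
Qed.

Lemma cokernel_epi X Y Q (p : hom Y Q) (f : hom X Y) :
  is_cokernel p f -> is_epi p.
Proof.
move=> [pf pU] Z u v E; have [|w [_ wU]] := pU Z (u ∘ p).
  by rewrite -comp_assoc pf comp_zerom.
by rewrite -(wU u erefl) (wU v (esym E)).
Qed.

Lemma kernelI N X Y (i : hom N X) (f : hom X Y) :
  is_mono i -> f ∘ i = zerom N Y ->
  (forall Z (h : hom Z X), f ∘ h = zerom Z Y -> exists u : hom Z N, i ∘ u = h) ->
  is_kernel i f.
Proof.
move=> iM fi iP; split=> // Z h /iP [u uE]; exists u; split=> // v vE.
by apply: iM; rewrite uE.
Qed.

Lemma cokernelI X Y Q (p : hom Y Q) (f : hom X Y) :
  is_epi p -> p ∘ f = zerom X Q ->
  (forall Z (h : hom Y Z), h ∘ f = zerom X Z -> exists u : hom Q Z, u ∘ p = h) ->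
  is_cokernel p f.
Proof.
move=> pE pf pP; split=> // Z h /pP [u uE]; exists u; split=> // v vE.
by apply: pE; rewrite uE.
Qed.

Lemma kernel_lift N X Y Z (i : hom N X) (f : hom X Y) (h : hom Z X) :
  is_kernel i f -> f ∘ h = zerom Z Y -> exists u : hom Z N, i ∘ u = h.
Proof. by move=> [_ iU] /iU [u [uE _]]; exists u. Qed.

Lemma cokernel_desc X Y Q Z (p : hom Y Q) (f : hom X Y) (h : hom Y Z) :
  is_cokernel p f -> h ∘ f = zerom X Z -> exists u : hom Q Z, u ∘ p = h.
Proof. by move=> [_ pU] /pU [u [uE _]]; exists u. Qed.

Lemma cokernel_coequalizer X Y Q (p : hom Y Q) (f : hom X Y) :
  is_cokernel p f <-> is_coequalizer f (zerom X Y) p.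
Proof.
split=> -[pf pU]; split.
- by rewrite pf comp_zerom.
- by move=> Z h; rewrite comp_zerom => /pU.
- by rewrite pf comp_zerom.
by move=> Z h hf; apply: pU; rewrite hf comp_zerom.
Qed.

Lemma zero_object_hom X Y (f g : hom X Y) : zero_object X -> f = g.
Proof. by move=> /(_ Y) [_ [u [_ uU]]]; rewrite -(uU f) // (uU g). Qed.

Lemma hom_zero_object X Y (f g : hom X Y) : zero_object Y -> f = g.
Proof. by move=> /(_ X) [[u [_ uU]] _]; rewrite -(uU f) // (uU g). Qed.

Lemma zero_objectI X : idm X = zerom X X -> zero_object X.
Proof.
move=> E Y; split; [exists (zerom Y X)|exists (zerom X Y)]; split=> // f _.
  by rewrite -[f]comp_id_l E zerom_comp.
by rewrite -[f]comp_id_r E comp_zerom.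
Qed.

Lemma mono_zero_object X Y (f : hom X Y) :
  is_mono f -> zero_object Y -> zero_object X.
Proof. by move=> fM Y0; apply/zero_objectI/fM/hom_zero_object. Qed.

Lemma epi_zero_object X Y (f : hom X Y) :
  is_epi f -> zero_object X -> zero_object Y.
Proof. by move=> fE X0; apply/zero_objectI/fE/zero_object_hom. Qed.

Hypothesis Cab : is_abelian C.

Lemma mono_kernel X Y Q (i : hom X Y) (p : hom Y Q) :
  is_mono i -> is_cokernel p i -> is_kernel i p.
Proof.
move=> iM pC; apply: kernelI => [//||Z h hE]; first exact: pC.1.
have [W [g gK]] := abelian_mono Cab iM.
have [g' g'E] := cokernel_desc pC gK.1.
by apply: (kernel_lift gK); rewrite -g'E -comp_assoc hE comp_zerom.
Qed.

Lemma epi_cokernel X Y Q (i : hom X Y) (p : hom Y Q) :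
  is_epi p -> is_kernel i p -> is_cokernel p i.
Proof.
move=> pE iK; apply: cokernelI => [//||Z h hE]; first exact: iK.1.
have [W [g gC]] := abelian_epi Cab pE.
have [g' g'E] := kernel_lift iK gC.1.
by apply: (cokernel_desc gC); rewrite -g'E comp_assoc hE zerom_comp.
Qed.

Lemma mono_epi_iso X Y (f : hom X Y) : is_mono f -> is_epi f -> is_iso f.
Proof.
move=> fM fE; have [Z [g gK]] := abelian_mono Cab fM.
have g0 : g = zerom Y Z by apply: fE; rewrite gK.1 zerom_comp.
have [|s sE] := kernel_lift (h := idm Y) gK; first by rewrite g0 zerom_comp.
exists s; split=> //; apply: fM.
by rewrite comp_assoc sE comp_id_l comp_id_r.
Qed.

(** The map from the coimage is mono: if [r ∘ u = 0], the cokernel [c] of [u]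
    makes [c ∘ q] a cokernel through which [q] itself factors, so [c] is split
    mono and [u] vanishes. *)
Lemma coimage_mono N X Y Q (f : hom X Y) (i : hom N X) (q : hom X Q)
    (r : hom Q Y) :
  is_kernel i f -> is_cokernel q i -> r ∘ q = f -> is_mono r.
Proof.
move=> iK qC E; apply: mono_zero => Z u ru.
have [T [c cC]] := abelian_cokernel Cab u.
have [r' r'E] := cokernel_desc cC ru.
have cqE : is_epi (c ∘ q).
  exact: is_epi_comp (cokernel_epi cC) (cokernel_epi qC).
have [W [h hC]] := abelian_epi Cab cqE.
have [|h' h'E] := kernel_lift (h := h) iK.
    by rewrite -E -r'E -!comp_assoc (comp_assoc c) hC.1 comp_zerom.
have [|t tE] := cokernel_desc (h := q) hC.
  by rewrite -h'E comp_assoc qC.1 zerom_comp.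
have tc : t ∘ c = idm Q.
  by apply: (cokernel_epi qC); rewrite -comp_assoc tE comp_id_l.
by apply: (split_mono tc); rewrite cC.1 comp_zerom.
Qed.

(** The five lemma in the form needed to compare a right exact with a left
    exact functor: no exactness is assumed at the outer ends of the rows, since
    the outer isomorphisms force the top row to be exact on the left and the
    bottom row to be exact on the right. *)
Lemma five_lemma F1 F2 F3 G1 G2 G3 (f : hom F1 F2) (f' : hom F2 F3)
    (g : hom G1 G2) (g' : hom G2 G3) (a1 : hom F1 G1) (a2 : hom F2 G2)
    (a3 : hom F3 G3) :
  is_cokernel f' f -> is_kernel g g' -> a2 ∘ f = g ∘ a1 -> a3 ∘ f' = g' ∘ a2 ->
  is_iso a1 -> is_iso a3 -> is_iso a2.
Proof.
move=> fC gK E1 E2 [b1 [b1K b1K']] [b3 [b3K b3K']].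
have fM : is_mono f.
  apply: mono_zero => Z u fu; apply: (split_mono b1K); apply: (kernel_mono gK).
  by rewrite comp_assoc -E1 -comp_assoc fu !comp_zerom.
have gE : is_epi g'.
  apply: epi_zero => Z u gu; apply: (split_epi b3K'); apply: (cokernel_epi fC).
  by rewrite -comp_assoc E2 comp_assoc gu !zerom_comp.
apply: mono_epi_iso.
  apply: mono_zero => Z u au.
  have [|v vE] := kernel_lift (h := u) (mono_kernel fM fC).
    by apply: (split_mono b3K); rewrite comp_assoc E2 -comp_assoc au !comp_zerom.
  rewrite -vE; have -> : v = zerom Z F1; last by rewrite comp_zerom.
  apply: (split_mono b1K); apply: (kernel_mono gK).
  by rewrite comp_assoc -E1 -comp_assoc vE au !comp_zerom.
apply: epi_zero => Z u ua.
have [|v vE] := cokernel_desc (h := u) (epi_cokernel gE gK).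
  by apply: (split_epi b1K'); rewrite -comp_assoc -E1 comp_assoc ua !zerom_comp.
rewrite -vE; have -> : v = zerom G3 Z; last by rewrite zerom_comp.
apply: (split_epi b3K'); apply: (cokernel_epi fC).
by rewrite -comp_assoc E2 comp_assoc vE ua !zerom_comp.
Qed.

Lemma simple_epi Y S (f : hom Y S) :
  simple_object S -> f <> zerom Y S -> is_epi f.
Proof.
move=> [_ sS] f0.
have [N [i iK]] := abelian_kernel Cab f.
have [Q [q qC]] := abelian_cokernel Cab i.
have [r rE] := cokernel_desc qC iK.1.
have [Q0|rI] := sS _ r (coimage_mono iK qC rE).
  by case: f0; rewrite -rE (hom_zero_object q (zerom Y Q) Q0) comp_zerom.
by rewrite -rE; exact: is_epi_comp (is_iso_epi rI) (cokernel_epi qC).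
Qed.

(** A numerical bound replaces [finite_length], because a filtration of the
    underlying object of a module need not consist of submodules: the induction
    on modules can only use how long it is. *)
Inductive length_le : nat -> C -> Prop :=
| length_le_zero n X : zero_object X -> length_le n X
| length_le_ext n X Y S (i : hom Y X) (p : hom X S) :
    is_mono i -> is_cokernel p i -> length_le n Y -> simple_object S ->
    length_le n.+1 X.

Lemma finite_length_le X : finite_length X -> exists n, length_le n X.
Proof.
elim=> [Y Y0|Y Z S i p iM pC _ [n nZ] sS]; first by exists 0; left.
by exists n.+1; apply: length_le_ext iM pC nZ sS.
Qed.

(** Length is additive on short exact sequences [Y -> X -> Q]. A step
    [X' -> X -> S] of the filtration of [X] contributes to [Q] if [Y] lies in
    [X'], and otherwise to [Y], which then maps onto [S] with kernel the
    intersection of [Y] and [X']. *)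
Lemma length_le_split n X Y Q (j : hom Y X) (q : hom X Q) :
  length_le n X -> is_kernel j q -> is_epi q ->
  exists a b, [/\ length_le a Y, length_le b Q & a + b <= n].
Proof.
move=> nX; elim: nX Y Q j q => {n X} [n X X0|n X X' S i p iM pC nX' IH sS];
  move=> Y Q j q jK qE.
  exists 0, 0; split=> //; left; first exact: mono_zero_object (kernel_mono jK) X0.
  exact: epi_zero_object qE X0.
have iK := mono_kernel iM pC.
have [pj|pj] := pselect (p ∘ j = zerom Y S).
  have [j' j'E] := kernel_lift iK pj.
  have j'K : is_kernel j' (q ∘ i).
    apply: kernelI => [Z u v E||Z h hE].
    - by apply: (kernel_mono jK); rewrite -j'E -!comp_assoc E.
    - by rewrite -comp_assoc j'E jK.1.
    have [|w wE] := kernel_lift (h := i ∘ h) jK; first by rewrite comp_assoc.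
    by exists w; apply: iM; rewrite comp_assoc j'E.
  have [Q' [q' q'C]] := abelian_cokernel Cab j'.
  have q'K := mono_kernel (kernel_mono j'K) q'C.
  have [a [b [aY bQ' abn]]] := IH _ _ _ _ q'K (cokernel_epi q'C).
  have [r rE] := cokernel_desc q'C j'K.1.
  have [s sE] := cokernel_desc (epi_cokernel qE jK) pj.
  exists a, b.+1; split=> //; last by rewrite addnS.
  apply: (length_le_ext (i := r) (p := s)) bQ' sS.
    exact: coimage_mono j'K q'C rE.
  apply: cokernelI.
  - by move=> Z u v E; apply: (cokernel_epi pC); rewrite -sE !comp_assoc E.
  - apply: (cokernel_epi q'C).
    by rewrite -comp_assoc rE comp_assoc sE pC.1 zerom_comp.
  move=> Z h hr; have [|g gE] := cokernel_desc (h := h ∘ q) pC.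
    by rewrite -comp_assoc -rE comp_assoc hr zerom_comp.
  by exists g; apply: qE; rewrite -comp_assoc sE.
have pjE := simple_epi sS pj.
have [Y' [l lK]] := abelian_kernel Cab (p ∘ j).
have [|j' j'E] := kernel_lift (h := j ∘ l) iK; first by rewrite comp_assoc lK.1.
have j'K : is_kernel j' (q ∘ i).
  apply: kernelI => [Z u v E||Z h hE].
  - apply: (kernel_mono lK); apply: (kernel_mono jK).
    by rewrite !comp_assoc -j'E -!comp_assoc E.
  - by rewrite -comp_assoc j'E comp_assoc jK.1 zerom_comp.
  have [|w wE] := kernel_lift (h := i ∘ h) jK; first by rewrite comp_assoc.
  have [|w' w'E] := kernel_lift (h := w) lK.
    by rewrite -comp_assoc wE comp_assoc pC.1 zerom_comp.
  by exists w'; apply: iM; rewrite comp_assoc j'E -comp_assoc w'E.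
have qiE : is_epi (q ∘ i).
  apply: epi_zero => Z h hqi; apply: qE; rewrite zerom_comp.
  have [|g gE] := cokernel_desc (h := h ∘ q) pC; first by rewrite -comp_assoc.
  rewrite -gE; suff -> : g = zerom S Z by rewrite zerom_comp.
  by apply: pjE; rewrite comp_assoc gE -comp_assoc jK.1 comp_zerom zerom_comp.
have [a [b [aY' bQ abn]]] := IH _ _ _ _ j'K qiE.
exists a.+1, b; split=> //.
exact: length_le_ext (kernel_mono lK) (epi_cokernel pjE lK) aY' sS.
Qed.

Lemma length_le0 X : length_le 0 X -> zero_object X.
Proof. by move=> l0; inversion l0. Qed.
End Exactness.

(** * Duals as internal homs *)

Section Duals.
Context {E : monoidal_category}.
Implicit Types T W X Y Z H : E.

Lemma lunit_munit : lunit munit = runit munit :> hom (munit ⊗ munit : E) munit.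
Proof.
apply: tensm_unit_inj; rewrite -triangle -lunit_assoc; congr (_ ∘ _).
by apply: (split_mono (lunitK munit)); rewrite lunit_nat.
Qed.

Definition internal_hom X Z H (e : hom (H ⊗ X) Z) : Prop :=
  forall T (f : hom (T ⊗ X) Z), exists! phi : hom T H, e ∘ (phi ⊠ idm X) = f.

Lemma internal_hom_uniq X Z H (e : hom (H ⊗ X) Z) T (phi psi : hom T H) :
  internal_hom e -> e ∘ (phi ⊠ idm X) = e ∘ (psi ⊠ idm X) -> phi = psi.
Proof.
move=> /(_ T (e ∘ (phi ⊠ idm X))) [w [_ wU]] E1.
by rewrite -(wU phi) // (wU psi).
Qed.

Lemma internal_hom_iso X Z H H' (e : hom (H ⊗ X) Z) (e' : hom (H' ⊗ X) Z)
    (phi : hom H H') :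
  internal_hom e -> internal_hom e' -> e' ∘ (phi ⊠ idm X) = e -> is_iso phi.
Proof.
move=> eU e'U E1; have [psi [E2 _]] := eU _ e'.
exists psi; split.
  apply: (internal_hom_uniq eU).
  by rewrite tensm_compl comp_assoc E2 E1 tensm_id comp_id_r.
apply: (internal_hom_uniq e'U).
by rewrite tensm_compl comp_assoc E1 E2 tensm_id comp_id_r.
Qed.

(** If [e] exhibits [H] as the internal hom from [X] to [munit], the transpose of
    [tens_ev Z e] is the comparison from [Z ⊗ H] to the internal hom from [X] to
    [Z]. *)
Definition tens_ev Z X H (e : hom (H ⊗ X) munit) : hom ((Z ⊗ H) ⊗ X) Z :=
  runit Z ∘ (idm Z ⊠ e) ∘ assoc Z H X.

Lemma tens_ev_nat Z X X' H H' (e : hom (H ⊗ X) munit) (e' : hom (H' ⊗ X') munit)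
    (g : hom H H') (f : hom X' X) :
  e' ∘ (g ⊠ idm X') = e ∘ (idm H ⊠ f) ->
  tens_ev Z e' ∘ ((idm Z ⊠ g) ⊠ idm X') = tens_ev Z e ∘ (idm (Z ⊗ H) ⊠ f).
Proof.
move=> E1; rewrite /tens_ev -!comp_assoc assoc_nat -tensm_id assoc_nat.
by rewrite !(comp_eq _ (esym (tensm_compr _ _ _))) E1.
Qed.

Section Zigzag.
Variables (X H : E) (e : hom (H ⊗ X) munit) (c : hom munit (X ⊗ H)).

Definition left_zigzag : Prop :=
  runit X ∘ (idm X ⊠ e) ∘ assoc X H X ∘ (c ⊠ idm X) ∘ lunit' X = idm X.

Definition right_zigzag : Prop :=
  lunit H ∘ (e ⊠ idm H) ∘ assoc' H X H ∘ (idm H ⊠ c) ∘ runit' H = idm H.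

Hypothesis zig : left_zigzag.

Lemma left_zigzag_tens T :
  runit (T ⊗ X) ∘ (idm (T ⊗ X) ⊠ e) ∘ assoc (T ⊗ X) H X ∘
    ((assoc' T X H ∘ (idm T ⊠ c) ∘ runit' T) ⊠ idm X) = idm (T ⊗ X).
Proof.
have zigX : runit X ∘ (idm X ⊠ e) ∘ assoc X H X ∘ (c ⊠ idm X) = lunit X.
  have := congr1 (fun t => t ∘ lunit X) zig.
  by rewrite -!comp_assoc lunitK comp_id_r comp_id_l.
rewrite !tensm_compl -runit_assoc -!comp_assoc.
rewrite -(tensm_id T X) (comp_eq2 _ (assoc_nat _ _ _)).
rewrite (comp_eq2 _ (esym (pentagon T X H X))) -!comp_assoc.
rewrite (comp_eq _ (esym (tensm_compl _ _ _))) assoc'K tensm_id comp_id_l.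
rewrite (comp_eq2 _ (assoc_nat _ _ _)) !(comp_eq _ (esym (tensm_compr _ _ _))).
rewrite -!comp_assoc zigX (comp_eq _ (triangle _ _)).
by rewrite -tensm_compl runit'K !tensm_id.
Qed.

(** The second triangle identity is an equality of endomorphisms of [H]; tested
    against [e] it reduces to the first. *)
Lemma internal_hom_right_zigzag : internal_hom e -> right_zigzag.
Proof.
move=> eU; apply: (internal_hom_uniq eU); rewrite tensm_id comp_id_r !tensm_compl.
rewrite -lunit_assoc -!comp_assoc (comp_eq2 _ (esym (lunit_nat e))).
rewrite (comp_eq2 _ (assoc_nat _ _ _)) tensm_id.
rewrite (comp_eq2 _ (esym (tensm_swap _ _))) lunit_munit.
rewrite (comp_eq2 _ (runit_nat _)) -!tensm_compl.
by rewrite left_zigzag_tens comp_id_r.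
Qed.

(** Tensoring with a dual of [X] computes internal homs out of [X]: both
    triangle identities, tensored with another object, say that [f] and
    [(f ⊠ idm H) ∘ (idm T ⊠ c)] determine each other. *)
Lemma tens_ev_internal_hom Z : right_zigzag -> internal_hom (tens_ev Z e).
Proof.
move=> zag T f.
exists ((f ⊠ idm H) ∘ assoc' T X H ∘ (idm T ⊠ c) ∘ runit' T); split.
  rewrite /tens_ev tensm_compl -!comp_assoc.
  rewrite (comp_eq2 _ (assoc_nat _ _ _)) tensm_id.
  rewrite (comp_eq2 _ (esym (tensm_swap _ _))).
  by rewrite (comp_eq2 _ (runit_nat _)) left_zigzag_tens comp_id_r.
move=> g <-; rewrite !tensm_compl -!comp_assoc.
rewrite (comp_eq2 _ (esym (assoc'_nat _ _ _))) tensm_id.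
rewrite (comp_eq2 _ (tensm_swap _ _)) -runit'_nat.
rewrite (comp_eq2 _ (esym (pentagon_r Z H X H))) -!comp_assoc.
rewrite (comp_eq2 _ (esym (assoc'_nat _ _ _))) -triangle -!comp_assoc.
rewrite (comp_eq _ (assoc'K _ _ _)) comp_id_l.
rewrite -(tensm_id Z H) (comp_eq2 _ (assoc_nat _ _ _)).
have aE : assoc Z H munit ∘ runit' (Z ⊗ H) = idm Z ⊠ runit' H.
  rewrite -[RHS]comp_id_r -(runit'K (Z ⊗ H)) -runit_assoc.
  rewrite -!comp_assoc (comp_eq _ (esym (tensm_compr _ _ _))).
  by rewrite runitK tensm_id comp_id_l.
rewrite (comp_eq _ aE) !(comp_eq _ (esym (tensm_compr _ _ _))).
by rewrite -!comp_assoc zag tensm_id comp_id_l.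
Qed.
End Zigzag.

(** Any evaluation representing [hom (- ⊗ X) munit] can serve as that of a left
    dual, since it is uniquely isomorphic to the given one. *)
Lemma left_dual_coev X Y H (e : hom (H ⊗ X) munit) :
  is_left_dual Y X -> internal_hom e ->
  exists c : hom munit (X ⊗ H), left_zigzag e c.
Proof.
move=> [ev [coev [zig _]]] eU; have [a [aE _]] := eU _ ev.
exists ((idm X ⊠ a) ∘ coev); rewrite /left_zigzag -[RHS]zig tensm_compl -!comp_assoc.
rewrite (comp_eq2 _ (assoc_nat _ _ _)).
by rewrite (comp_eq _ (esym (tensm_compr _ _ _))) aE.
Qed.

(** If [X] has a left dual, then both sides of the comparison
    [Z ⊗ Hom (X, munit) -> Hom (X, Z)] are internal homs from [X] to [Z]. *)
Lemma left_dual_comparison_iso X Y Z H G (e : hom (H ⊗ X) munit)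
    (e' : hom (G ⊗ X) Z) (phi : hom (Z ⊗ H) G) :
  is_left_dual Y X -> internal_hom e -> internal_hom e' ->
  e' ∘ (phi ⊠ idm X) = tens_ev Z e -> is_iso phi.
Proof.
move=> XY eU e'U E1; have [c zig] := left_dual_coev XY eU.
apply: (internal_hom_iso _ e'U E1); apply: (tens_ev_internal_hom zig).
exact: internal_hom_right_zigzag zig eU.
Qed.

(** Conversely the coevaluation is the name of the identity of [X], transported
    along the comparison with [Z = X]. *)
Lemma comparison_iso_left_dual X H G (e : hom (H ⊗ X) munit)
    (e' : hom (G ⊗ X) X) (phi : hom (X ⊗ H) G) :
  internal_hom e -> internal_hom e' -> e' ∘ (phi ⊠ idm X) = tens_ev X e ->
  is_iso phi -> is_left_dual H X.
Proof.
move=> eU e'U E1 [psi [_ phiK]]; have [u [uE _]] := e'U _ (lunit X).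
have zig : left_zigzag e (psi ∘ u).
  have {}E1 := esym E1; rewrite /tens_ev in E1.
  rewrite /left_zigzag (comp_eq3 _ E1) -comp_assoc.
  rewrite (comp_eq _ (esym (tensm_compl _ _ _))) (comp_assoc phi) phiK comp_id_l.
  by rewrite comp_assoc uE lunit'K.
by exists e, (psi ∘ u); split; [|exact: internal_hom_right_zigzag].
Qed.
End Duals.

(** * The reversed monoidal category *)

Section Reverse.
Variable E : monoidal_category.

Definition rev_struct : monoidal_struct E.
Proof.
apply: (@MonoidalStruct E munit (fun X Y => Y ⊗ X)
  (fun X X' Y Y' f g => g ⊠ f) (fun X Y Z => assoc' Z Y X)
  (fun X Y Z => assoc Z Y X) (@runit E) (@runit' E) (@lunit E) (@lunit' E)) => *.
- exact: tensm_id.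
- exact: tensm_comp.
- exact: assoc'K.
- exact: assocK.
- exact: runitK.
- exact: runit'K.
- exact: lunitK.
- exact: lunit'K.
- exact: assoc'_nat.
- exact: runit_nat.
- exact: lunit_nat.
- exact: pentagon'.
- by rewrite -triangle -comp_assoc assoc'K comp_id_r.
Defined.

Definition rev_monoidal : monoidal_category := MonoidalCategory rev_struct.

Lemma rev_left_dual (X Y : E) :
  @is_left_dual rev_monoidal Y X <-> @is_left_dual E X Y.
Proof. by split=> -[ev [coev [zig zag]]]; exists ev, coev; split. Qed.
End Reverse.

(** * Extensions of objects with left duals *)

Lemma fmap_iso (C D : category) (F : functor C D) (X Y : C) (f : hom X Y) :
  is_iso f -> is_iso (fmap F f).
Proof.
move=> [g [gf fg]]; exists (fmap F g).
by rewrite -!fmap_comp gf fg !fmap_id.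
Qed.

(** Tensoring with an object that is itself a left dual is a right adjoint. *)
Lemma tens_mono (E : monoidal_category) (W Y X X' : E) (i : hom X X') :
  is_left_dual W Y -> is_mono i -> is_mono (i ⊠ idm W).
Proof.
move=> [ev [coev [zig zag]]] iM Z u v E1.
apply: (internal_hom_uniq (@tens_ev_internal_hom _ _ _ _ _ zig X zag)).
have tevN : i ∘ tens_ev X ev = tens_ev X' ev ∘ ((i ⊠ idm W) ⊠ idm Y).
  rewrite /tens_ev -!comp_assoc assoc_nat tensm_id.
  by rewrite (comp_eq2 _ (esym (tensm_swap _ _))) (comp_eq2 _ (runit_nat _)).
by apply: iM; rewrite !(comp_eq _ tevN) -!comp_assoc -!tensm_compl E1.
Qed.

Section Pairings.
Variables (E : monoidal_category) (C : category) (U : functor E C) (K : C).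
Implicit Types M N T X Y Z W : E.

(** [P] exhibits [M] as representing the presheaf [hom (U (- ⊗ N)) K]. *)
Definition left_pairing M N (P : hom (U (M ⊗ N)) K) : Prop :=
  forall T (f : hom (U (T ⊗ N)) K),
    exists! phi : hom T M, P ∘ fmap U (phi ⊠ idm N) = f.

Lemma left_pairing_uniq M N (P : hom (U (M ⊗ N)) K) T (phi psi : hom T M) :
  left_pairing P -> P ∘ fmap U (phi ⊠ idm N) = P ∘ fmap U (psi ⊠ idm N) ->
  phi = psi.
Proof.
move=> /(_ T (P ∘ fmap U (phi ⊠ idm N))) [w [_ wU]] E1.
by rewrite -(wU phi) // (wU psi).
Qed.

Lemma fmap_tens_assoc X X' Y Y' W W' (f : hom X X') (g : hom Y Y')
    (h : hom W W') :
  fmap U (assoc X' Y' W') ∘ fmap U ((f ⊠ g) ⊠ h) =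
  fmap U (f ⊠ (g ⊠ h)) ∘ fmap U (assoc X Y W).
Proof. by rewrite -!fmap_comp assoc_nat. Qed.

(** If [Z] is paired with [W], then a partner of [X ⊗ W] is an internal hom
    from [X] to [Z], since [hom (T ⊗ X) Z] is [hom (U ((T ⊗ X) ⊗ W)) K]. *)
Lemma pairing_internal_hom X Z W H (Q : hom (U (Z ⊗ W)) K)
    (P : hom (U (H ⊗ (X ⊗ W))) K) (e : hom (H ⊗ X) Z) :
  left_pairing Q -> left_pairing P ->
  Q ∘ fmap U (e ⊠ idm W) = P ∘ fmap U (assoc H X W) -> internal_hom e.
Proof.
move=> QU PU E1 T f.
have eP (phi : hom T H) : Q ∘ fmap U ((e ∘ (phi ⊠ idm X)) ⊠ idm W) =
    P ∘ fmap U (phi ⊠ idm (X ⊗ W)) ∘ fmap U (assoc T X W).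
  rewrite tensm_compl fmap_comp comp_assoc E1 -comp_assoc fmap_tens_assoc.
  by rewrite tensm_id.
have [phi [phiE phiU]] := PU T (Q ∘ fmap U (f ⊠ idm W) ∘ fmap U (assoc' T X W)).
exists phi; split=> [|psi psiE].
  apply: (left_pairing_uniq QU); rewrite eP comp_assoc phiE -!comp_assoc.
  by rewrite -fmap_comp assocK fmap_id comp_id_r.
apply: phiU; rewrite -psiE (comp_eq _ (eP psi)) -!comp_assoc -fmap_comp assoc'K.
by rewrite fmap_id comp_id_r.
Qed.
End Pairings.

(** The monoidal category [E] lies over an abelian category by a functor [U]
    that detects isomorphisms; exactness in [E] means exactness of the image
    under [U]. Every object has a partner under a pairing with values in [K],
    and passing to partners is exact. *)
Section Devissage.
Variables (k : fieldType) (C : linear_category k) (Cab : is_abelian C).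
Variables (E : monoidal_category) (U : functor E C) (K : C).
Implicit Types M N T X Y Z W Q : E.

Hypothesis U_iso : forall X Y (f : hom X Y), is_iso (fmap U f) -> is_iso f.
Hypothesis U_mono : forall X Y (f : hom X Y), is_mono f <-> is_mono (fmap U f).
Hypothesis tens_cokernel_l : forall X Y Q Z (f : hom X Y) (p : hom Y Q),
  is_cokernel (fmap U p) (fmap U f) ->
  is_cokernel (fmap U (p ⊠ idm Z)) (fmap U (f ⊠ idm Z)).
Hypothesis tens_cokernel_r : forall X Y Q Z (f : hom X Y) (p : hom Y Q),
  is_cokernel (fmap U p) (fmap U f) ->
  is_cokernel (fmap U (idm Z ⊠ p)) (fmap U (idm Z ⊠ f)).

Variables (D : E -> E) (P : forall X, hom (U (D X ⊗ X)) K).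

Definition is_transpose X Y (f : hom X Y) (f' : hom (D Y) (D X)) : Prop :=
  P X ∘ fmap U (f' ⊠ idm X) = P Y ∘ fmap U (idm (D Y) ⊠ f).

Hypothesis P_pairing : forall X, left_pairing (P X).
Hypothesis D_kernel : forall X Y Q (f : hom X Y) (p : hom Y Q) f' p',
  is_transpose f f' -> is_transpose p p' ->
  is_cokernel (fmap U p) (fmap U f) -> is_kernel (fmap U p') (fmap U f').
Hypothesis D_cokernel : forall X Y Q (f : hom X Y) (p : hom Y Q) f' p',
  is_transpose f f' -> is_transpose p p' ->
  is_kernel (fmap U f) (fmap U p) -> is_cokernel (fmap U f') (fmap U p').
Hypothesis partner : forall Z, exists W (Q : hom (U (Z ⊗ W)) K), left_pairing Q.

Let transpose_exists X Y (f : hom X Y) : exists f', is_transpose f f'.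
Proof.
have [f' [f'P _]] := P_pairing (P Y ∘ fmap U (idm (D Y) ⊠ f)).
by exists f'.
Qed.

Definition transpose X Y (f : hom X Y) : hom (D Y) (D X) :=
  projT1 (cid (transpose_exists f)).

Lemma transposeP X Y (f : hom X Y) : is_transpose f (transpose f).
Proof. exact: projT2 (cid (transpose_exists f)). Qed.

Section InternalHom.
Variables (Z W : E) (Q : hom (U (Z ⊗ W)) K).
Hypothesis Q_pairing : left_pairing Q.

Let ev_exists X : exists e : hom (D (X ⊗ W) ⊗ X) Z,
  Q ∘ fmap U (e ⊠ idm W) = P (X ⊗ W) ∘ fmap U (assoc _ X W).
Proof.
have [e [eP _]] := Q_pairing (P (X ⊗ W) ∘ fmap U (assoc _ X W)).
by exists e.
Qed.

Definition partner_ev X : hom (D (X ⊗ W) ⊗ X) Z := projT1 (cid (ev_exists X)).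

Lemma partner_evP X :
  Q ∘ fmap U (partner_ev X ⊠ idm W) = P (X ⊗ W) ∘ fmap U (assoc _ X W).
Proof. exact: projT2 (cid (ev_exists X)). Qed.

Lemma partner_ev_internal_hom X : internal_hom (partner_ev X).
Proof. exact: pairing_internal_hom Q_pairing (@P_pairing _) (partner_evP X). Qed.

Lemma partner_ev_nat X Y (f : hom X Y) :
  partner_ev X ∘ (transpose (f ⊠ idm W) ⊠ idm X) = partner_ev Y ∘ (idm _ ⊠ f).
Proof.
apply: (left_pairing_uniq Q_pairing); rewrite !tensm_compl !fmap_comp.
rewrite !comp_assoc !partner_evP -!comp_assoc !fmap_tens_assoc tensm_id.
by rewrite (comp_eq2 _ (transposeP (f ⊠ idm W))).
Qed.
End InternalHom.

Section Extension.
Variables (W1 Y1 : E) (Q1 : hom (U (munit ⊗ W1)) K).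
Hypotheses (Q1_pairing : left_pairing Q1) (W1_dual : is_left_dual W1 Y1).

(** With [Z] set to [X], the comparison from [Z ⊗ Hom (-, munit)] to [Hom (-, Z)]
    is a natural map whose source is right exact on the given sequence, because
    [- ⊗ W1] preserves its exactness, and whose target is left exact. Hence its
    invertibility at [X'] and [X''] implies invertibility at [X]. *)
Lemma left_dual_extension X' X X'' (i : hom X' X) (p : hom X X'') :
  is_kernel (fmap U i) (fmap U p) -> is_cokernel (fmap U p) (fmap U i) ->
  (exists Y, is_left_dual Y X') -> (exists Y, is_left_dual Y X'') ->
  exists Y, is_left_dual Y X.
Proof.
move=> iK pC [Y' X'Y'] [Y'' X''Y''].
have [W [Q QU]] := partner X.
pose e V := partner_ev Q1_pairing V.
pose e' V := partner_ev QU V.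
have eU V : internal_hom (e V) by exact: partner_ev_internal_hom.
have e'U V : internal_hom (e' V) by exact: partner_ev_internal_hom.
have phi_ex V : exists f, e' V ∘ (f ⊠ idm V) = tens_ev X (e V).
  by have [f [fE _]] := e'U V _ (tens_ev X (e V)); exists f.
pose phi V := projT1 (cid (phi_ex V)).
have phiE V : e' V ∘ (phi V ⊠ idm V) = tens_ev X (e V).
  exact: projT2 (cid (phi_ex V)).
have phiN V V' (f : hom V V') :
    phi V ∘ (idm X ⊠ transpose (f ⊠ idm W1)) = transpose (f ⊠ idm W) ∘ phi V'.
  apply: (internal_hom_uniq (e'U V)); rewrite !tensm_compl !comp_assoc phiE.
  rewrite partner_ev_nat -/(e' V') -comp_assoc -tensm_swap comp_assoc phiE.
  by apply: tens_ev_nat; exact: partner_ev_nat.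
exists (D (X ⊗ W1)); apply: (comparison_iso_left_dual (eU X) (e'U X) (phiE X)).
apply: U_iso.
have iW1K : is_kernel (fmap U (i ⊠ idm W1)) (fmap U (p ⊠ idm W1)).
  apply: (mono_kernel Cab); last exact: tens_cokernel_l.
  by apply/U_mono/(tens_mono W1_dual)/U_mono/(kernel_mono iK).
apply: (five_lemma Cab
  (f := fmap U (idm X ⊠ transpose (p ⊠ idm W1)))
  (f' := fmap U (idm X ⊠ transpose (i ⊠ idm W1)))
  (g := fmap U (transpose (p ⊠ idm W))) (g' := fmap U (transpose (i ⊠ idm W)))
  (a1 := fmap U (phi X'')) (a3 := fmap U (phi X'))).
- by apply/tens_cokernel_r/(D_cokernel (transposeP _) (transposeP _)).
- by apply/(D_kernel (transposeP _) (transposeP _))/tens_cokernel_l.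
- by rewrite -!fmap_comp phiN.
- by rewrite -!fmap_comp phiN.
- exact/fmap_iso/(left_dual_comparison_iso X''Y'' (eU X'') (e'U X'')).
exact/fmap_iso/(left_dual_comparison_iso X'Y' (eU X') (e'U X')).
Qed.
End Extension.
End Devissage.

(** * Perfect pairings from a dualizing object *)

Section Equivalence.
Variables (C D : category) (F : functor C D).
Hypothesis F_equiv : is_equivalence F.

Let faithful_of_retract (A B : category) (S : functor A B) (T : functor B A) :
  nat_iso (comp_functor T S) (id_functor A) ->
  forall (X Y : A) (f g : hom X Y), fmap S f = fmap S g -> f = g.
Proof.
move=> s X Y f g E; have [t [_ st]] := nat_map_iso s X.
apply: (split_epi st).
have /= <- := nat_mapP s f; have /= <- := nat_mapP s g.
by rewrite E.
Qed.

Lemma equivalence_faithful (X Y : C) (f g : hom X Y) : fmap F f = fmap F g -> f = g.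
Proof. by have [G [[s] _]] := F_equiv; exact: faithful_of_retract s _ _ _ _. Qed.

Lemma equivalence_full (X Y : C) (h : hom (F X) (F Y)) : exists f, fmap F f = h.
Proof.
have [G [[s] [r]]] := F_equiv.
have [s' [s's ss']] := nat_map_iso s X.
exists (s Y ∘ fmap G h ∘ s'); apply: (faithful_of_retract r).
have [t [ts st]] := nat_map_iso s Y; apply: (split_mono ts).
have /= -> := nat_mapP s (s Y ∘ fmap G h ∘ s').
by rewrite -!comp_assoc s's comp_id_r.
Qed.

Lemma equivalence_ess_surj (Y : D) : exists (X : C) (f : hom (F X) Y), is_iso f.
Proof.
have [G [_ [r]]] := F_equiv; exists (G Y), (r Y); exact: (nat_map_iso r Y).
Qed.
End Equivalence.

Section PerfectPairings.
Context {B : monoidal_category}.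
Implicit Types X Y Z T K : B.

(** The mirror image of [internal_hom]. *)
Definition right_perfect X Y K (P : hom (X ⊗ Y) K) : Prop :=
  forall T (f : hom (X ⊗ T) K), exists! phi : hom T Y, P ∘ (idm X ⊠ phi) = f.

Lemma right_perfect_uniq X Y K (P : hom (X ⊗ Y) K) T (phi psi : hom T Y) :
  right_perfect P -> P ∘ (idm X ⊠ phi) = P ∘ (idm X ⊠ psi) -> phi = psi.
Proof.
move=> /(_ T (P ∘ (idm X ⊠ phi))) [w [_ wU]] E1.
by rewrite -(wU phi) // (wU psi).
Qed.
End PerfectPairings.

Section DualPairings.
Variables (B : braided_category) (D : dualizing_object B).
Implicit Types X Y Z T : B.
Local Notation K := (dual_base D).

Lemma dual_map_inj X Y (f g : hom X Y) : dual_map D f = dual_map D g -> f = g.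
Proof. exact: (equivalence_faithful (dualizing_equiv D) (X := Y) (Y := X)). Qed.

Lemma dual_map_full X Y (h : hom (dual D Y) (dual D X)) :
  exists f : hom X Y, dual_map D f = h.
Proof. exact: (equivalence_full (dualizing_equiv D) (X := Y) (Y := X) h). Qed.

Lemma dual_ess_surj Y : exists X (f : hom (dual D X) Y), is_iso f.
Proof. exact: (equivalence_ess_surj (dualizing_equiv D) Y). Qed.

Lemma dual_ev_left X : internal_hom (dual_ev D X).
Proof. by move=> T f; exact: dual_rep. Qed.

(** Representing [hom (X ⊗ -) K] on the other side uses that the duality is fully
    faithful. *)
Lemma dual_ev_right X : right_perfect (dual_ev D X).
Proof.
move=> T f; have [g gE] := dual_map_full (curry f).
exists g; split=> [|h hE]; first by rewrite -dual_mapP gE curryK.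
by apply: dual_map_inj; rewrite gE; apply: curry_uniq; rewrite dual_mapP.
Qed.

(** Because of the braiding the dual of [X] is also its partner on the other
    side. The definition is locked to keep it from unfolding in rewrites. *)
Definition dual_coev X : hom (X ⊗ dual D X) K :=
  locked (dual_ev D X ∘ braid' (dual D X) X).

Lemma dual_coevE X : dual_coev X = dual_ev D X ∘ braid' (dual D X) X.
Proof. by rewrite /dual_coev -lock. Qed.

Lemma dual_coev_left X : internal_hom (dual_coev X).
Proof.
move=> T f; have [g [gE gU]] := dual_ev_right (f ∘ braid (dual D X) T).
exists g; split=> [|h hE].
  rewrite dual_coevE -comp_assoc braid'_nat comp_assoc gE -comp_assoc braid'K.
  by rewrite comp_id_r.
apply: gU; rewrite -hE !dual_coevE -!comp_assoc (comp_eq2 _ (braid'_nat _ _)).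
by rewrite braidK comp_id_r.
Qed.

Lemma dual_coev_right X : right_perfect (dual_coev X).
Proof.
move=> T f; have [g [gE gU]] := dual_ev_left (f ∘ braid T X).
exists g; split=> [|h hE].
  rewrite dual_coevE -comp_assoc braid'_nat comp_assoc gE -comp_assoc braid'K.
  by rewrite comp_id_r.
apply: gU; rewrite -hE !dual_coevE -!comp_assoc (comp_eq2 _ (braid'_nat _ _)).
by rewrite braidK comp_id_r.
Qed.

Lemma dual_coev_map X Y (f : hom X Y) :
  dual_coev X ∘ (idm X ⊠ dual_map D f) = dual_coev Y ∘ (f ⊠ idm (dual D Y)).
Proof.
by rewrite !dual_coevE -!comp_assoc !braid'_nat !comp_assoc dual_mapP.
Qed.
End DualPairings.

(** The dualizing object of [C], typed over the braided category that [C] coerces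
    to, so that inference finds it. *)
Definition ribbon_dualizing k (C : ribbon_GV_category k) : dualizing_object C :=
  rgv_dualizing C.

Section RibbonExact.
Variables (k : fieldType) (C : ribbon_GV_category k).
Local Notation L := (lfa_linear (rgv_lfa C)).
Local Notation D := (ribbon_dualizing C).
Implicit Types X Y Z Q : C.

Lemma tensm_zerol (X X' Y Y' : C) (g : hom Y Y') :
  (zerom (C := L) X X' : hom X X') ⊠ g = zerom (C := L) (X ⊗ Y) (X' ⊗ Y').
Proof.
have := @rgv_tens_linear_l k C X X' Y Y' (-1)%R (zerom X X') (zerom X X') g.
by rewrite /addm /scalem /zerom scaler0 addr0 scaleN1r addNr.
Qed.

Lemma tensm_zeror (X X' Y Y' : C) (f : hom X X') :
  f ⊠ (zerom (C := L) Y Y' : hom Y Y') = zerom (C := L) (X ⊗ Y) (X' ⊗ Y').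
Proof.
have := @rgv_tens_linear_r k C X X' Y Y' (-1)%R f (zerom Y Y') (zerom Y Y').
by rewrite /addm /scalem /zerom scaler0 addr0 scaleN1r addNr.
Qed.

Lemma dual_map_zero X Y :
  dual_map D (zerom (C := L) X Y) = zerom (C := L) (dual D Y) (dual D X).
Proof.
apply: curry_uniq; rewrite (@tensm_zerol (dual D Y) (dual D X) X X).
by rewrite (@tensm_zeror (dual D Y) (dual D Y) X Y) !(@comp_zerom k L).
Qed.

(** Being an antiequivalence, the duality exchanges kernels and cokernels. *)
Lemma dual_map_kernel X Y Q (f : hom X Y) (p : hom Y Q) :
  is_cokernel (C := L) p f -> is_kernel (C := L) (dual_map D p) (dual_map D f).
Proof.
move=> pC; apply: kernelI.
- move=> T u v E.
  have [T' [s [s' [s's ss']]]] := dual_ess_surj D T.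
  have [u1 u1E] := dual_map_full (u ∘ s : hom (dual D T') (dual D Q)).
  have [v1 v1E] := dual_map_full (v ∘ s : hom (dual D T') (dual D Q)).
  suff uv : u1 = v1 by apply: (split_epi ss'); rewrite -u1E -v1E uv.
  apply: (cokernel_epi pC); apply: (dual_map_inj (D := D)).
  by rewrite !(@dual_map_comp _ D) u1E v1E !comp_assoc E.
- by rewrite -(@dual_map_comp _ D) pC.1 dual_map_zero.
move=> T h hE.
have [T' [s [s' [s's ss']]]] := dual_ess_surj D T.
have [h1 h1E] := dual_map_full (h ∘ s : hom (dual D T') (dual D Y)).
have [|u uE] := cokernel_desc (h := h1) pC.
  apply: (dual_map_inj (D := D)); rewrite (@dual_map_comp _ D) h1E comp_assoc hE.
  by rewrite (@zerom_comp k L) dual_map_zero.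
exists (dual_map D u ∘ s'); rewrite comp_assoc -(@dual_map_comp _ D) uE h1E.
by rewrite -comp_assoc ss' comp_id_r.
Qed.

Lemma dual_map_cokernel X Y Q (f : hom X Y) (p : hom Y Q) :
  is_kernel (C := L) f p -> is_cokernel (C := L) (dual_map D f) (dual_map D p).
Proof.
move=> fK; apply: cokernelI.
- move=> T u v E.
  have [T' [s [s' [s's ss']]]] := dual_ess_surj D T.
  have [u1 u1E] := dual_map_full (s' ∘ u : hom (dual D X) (dual D T')).
  have [v1 v1E] := dual_map_full (s' ∘ v : hom (dual D X) (dual D T')).
  suff uv : u1 = v1 by apply: (split_mono ss'); rewrite -u1E -v1E uv.
  apply: (kernel_mono fK); apply: (dual_map_inj (D := D)).
  by rewrite !(@dual_map_comp _ D) u1E v1E -!comp_assoc E.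
- by rewrite -(@dual_map_comp _ D) fK.1 dual_map_zero.
move=> T h hE.
have [T' [s [s' [s's ss']]]] := dual_ess_surj D T.
have [h1 h1E] := dual_map_full (s' ∘ h : hom (dual D Y) (dual D T')).
have [|u uE] := kernel_lift (h := h1) fK.
  apply: (dual_map_inj (D := D)); rewrite (@dual_map_comp _ D) h1E -comp_assoc hE.
  by rewrite (@comp_zerom k L) dual_map_zero.
exists (s ∘ dual_map D u); rewrite -comp_assoc -(@dual_map_comp _ D) uE h1E.
by rewrite comp_assoc ss' comp_id_l.
Qed.

Lemma tensm_cokernel_l X Y Q Z (f : hom X Y) (p : hom Y Q) :
  is_cokernel (C := L) p f ->
  is_cokernel (C := L) (p ⊠ idm Z) (f ⊠ idm Z).
Proof.
move=> /cokernel_coequalizer pC; apply/cokernel_coequalizer.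
by have := coeq_tens Z pC; rewrite tensm_zerol.
Qed.

Lemma tensm_cokernel_r X Y Q Z (f : hom X Y) (p : hom Y Q) :
  is_cokernel (C := L) p f ->
  is_cokernel (C := L) (idm Z ⊠ p) (idm Z ⊠ f).
Proof.
move=> /cokernel_coequalizer pC; apply/cokernel_coequalizer.
by have := coeq_tens_l Z pC; rewrite tensm_zeror.
Qed.
End RibbonExact.

(** * Dual modules over a commutative algebra *)

Section RightModules.
Context {C : coeq_braided_category} (A : comm_algebra C).
Local Notation a := (alg_ob (comm_alg A)).

Lemma braid_tensr (X Y Z : C) :
  braid X (Y ⊗ Z) = assoc' Y Z X ∘ (idm Y ⊠ braid X Z) ∘ assoc Y X Z ∘
    (braid X Y ⊠ idm Z) ∘ assoc' X Y Z.
Proof.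
apply: assoc_mono; apply: assoc_epi; rewrite -comp_assoc hexagon.
rewrite -!comp_assoc assocK comp_id_r.
by rewrite (comp_eq _ (assoc'K _ _ _)) comp_id_l.
Qed.

Variables (X : C) (r : hom (X ⊗ a) X).
Hypothesis r_mul : r ∘ (r ⊠ idm a) = r ∘ (idm X ⊠ alg_mul A) ∘ assoc X a a.
Hypothesis r_one : r ∘ (idm X ⊠ alg_one A) = runit X.

Fact right_act_mul :
  (r ∘ braid a X) ∘ (alg_mul A ⊠ idm X) =
  (r ∘ braid a X) ∘ (idm a ⊠ (r ∘ braid a X)) ∘ assoc a a X.
Proof.
rewrite -!comp_assoc braid_nat braid_tensl.
have r_mul' : r ∘ (idm X ⊠ alg_mul A) = r ∘ (r ⊠ idm a) ∘ assoc' X a a.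
  by rewrite comp_assoc r_mul -!comp_assoc assoc'K comp_id_r.
rewrite (comp_eq2 _ r_mul') -!comp_assoc (comp_eq _ (assocK _ _ _)) comp_id_l.
have r_mulC W (h : hom W (X ⊗ (a ⊗ a))) :
    r ∘ (r ⊠ idm a) ∘ assoc' X a a ∘ (idm X ⊠ braid a a) ∘ h =
    r ∘ (r ⊠ idm a) ∘ assoc' X a a ∘ h.
  rewrite !(comp_eq3 _ (esym r_mul')) -!comp_assoc.
  by rewrite (comp_eq _ (esym (tensm_compr _ _ _))) alg_mulC.
rewrite tensm_compr -!comp_assoc (comp_eq2 _ (braid_nat _ _)) braid_tensr.
by rewrite -!comp_assoc r_mulC (comp_eq _ (assocK _ _ _)) comp_id_l.
Qed.

Fact right_act_one : (r ∘ braid a X) ∘ (alg_one A ⊠ idm X) = lunit X.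
Proof. by rewrite -comp_assoc braid_nat comp_assoc r_one runit_braid. Qed.

(** A right action of a commutative algebra is the right action induced by a
    unique left one. *)
Definition right_module : lmodule A := LModule right_act_mul right_act_one.

Lemma ract_right_module : ract right_module = r.
Proof. by rewrite ractE /= -comp_assoc braid'K comp_id_r. Qed.
End RightModules.

Section DualModules.
Context {C : coeq_braided_category} (D : dualizing_object C) (A : comm_algebra C).
Local Notation a := (alg_ob (comm_alg A)).
Local Notation K := (dual_base D).
Implicit Types M N T : lmodule A.

(** A pairing of modules with values in [K] is balanced if it factors through
    their tensor product over [A]. *)
Definition balanced M N (P : hom ((M : C) ⊗ N) K) : Prop :=
  P ∘ (ract M ⊠ idm (N : C)) = P ∘ (idm (M : C) ⊠ act N) ∘ assoc (M : C) a N.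

Section LeftDual.
Variable N : lmodule A.

Definition dual_ract : hom (dual D N ⊗ a) (dual D N) :=
  curry (dual_ev D N ∘ (idm (dual D N) ⊠ act N) ∘ assoc (dual D N) a N).

Lemma dual_ractP :
  dual_ev D N ∘ (dual_ract ⊠ idm (N : C)) =
  dual_ev D N ∘ (idm (dual D N) ⊠ act N) ∘ assoc (dual D N) a N.
Proof. exact: curryK. Qed.

Fact dual_ract_mul :
  dual_ract ∘ (dual_ract ⊠ idm a) =
  dual_ract ∘ (idm (dual D N) ⊠ alg_mul A) ∘ assoc (dual D N) a a.
Proof.
apply: (internal_hom_uniq (@dual_ev_left _ D N)); rewrite !tensm_compl.
rewrite !(comp_eq _ dual_ractP) -!comp_assoc.
rewrite (comp_eq2 _ (assoc_nat _ _ _)) assoc_nat tensm_id.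
rewrite (comp_eq2 _ (esym (tensm_swap _ _))) (comp_eq _ dual_ractP) -!comp_assoc.
rewrite -(tensm_id (dual D N) a) (comp_eq2 _ (assoc_nat _ _ _)) -pentagon.
rewrite (comp_eq _ (esym (tensm_compr _ _ _))) (comp_eq _ (esym (tensm_compr _ _ _))).
by rewrite (comp_eq _ (esym (tensm_compr _ _ _))) act_mul -comp_assoc.
Qed.

Fact dual_ract_one :
  dual_ract ∘ (idm (dual D N) ⊠ alg_one A) = runit (dual D N).
Proof.
apply: (internal_hom_uniq (@dual_ev_left _ D N)); rewrite !tensm_compl.
rewrite !(comp_eq _ dual_ractP) -!comp_assoc assoc_nat.
rewrite (comp_eq _ (esym (tensm_compr _ _ _))) act_one.
by rewrite triangle.
Qed.

Definition dual_module : lmodule A := right_module dual_ract_mul dual_ract_one.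

Lemma dual_ev_balanced : @balanced dual_module N (dual_ev D N).
Proof. by rewrite /balanced ract_right_module dual_ractP. Qed.
End LeftDual.

Section RightDual.
Variable M : lmodule A.

Let codual_act_exists : exists r : hom (a ⊗ dual D M) (dual D M),
  dual_coev D M ∘ (idm (M : C) ⊠ r) =
  dual_coev D M ∘ (ract M ⊠ idm (dual D M)) ∘ assoc' (M : C) a (dual D M).
Proof.
have [r [rE _]] := dual_coev_right (dual_coev D M ∘ (ract M ⊠ idm (dual D M))
  ∘ assoc' (M : C) a (dual D M)).
by exists r.
Qed.

Definition codual_act : hom (a ⊗ dual D M) (dual D M) :=
  projT1 (cid codual_act_exists).

Lemma codual_actP :
  dual_coev D M ∘ (idm (M : C) ⊠ codual_act) =
  dual_coev D M ∘ (ract M ⊠ idm (dual D M)) ∘ assoc' (M : C) a (dual D M).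
Proof. exact: projT2 (cid codual_act_exists). Qed.

Fact codual_act_mul :
  codual_act ∘ (alg_mul A ⊠ idm (dual D M)) =
  codual_act ∘ (idm a ⊠ codual_act) ∘ assoc a a (dual D M).
Proof.
apply: (right_perfect_uniq (@dual_coev_right _ D M)); rewrite !tensm_compr.
rewrite !(comp_eq _ codual_actP) -!comp_assoc.
rewrite assoc'_nat (comp_eq2 _ (assoc'_nat _ _ _)) tensm_id.
rewrite (comp_eq2 _ (tensm_swap _ _)) (comp_eq _ codual_actP) -!comp_assoc.
rewrite -(tensm_id a (dual D M)) (comp_eq2 _ (assoc'_nat _ _ _)).
rewrite (comp_eq _ (esym (tensm_compl _ _ _))) (comp_eq _ (esym (tensm_compl _ _ _))).
rewrite ract_mul !tensm_compl -!comp_assoc.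
rewrite (comp_eq2 _ (esym (pentagon_r _ _ _ _))) -!comp_assoc.
rewrite (comp_eq _ (assoc'K _ _ _)) comp_id_l -tensm_compr assocK.
by rewrite tensm_id comp_id_r.
Qed.

Fact codual_act_one :
  codual_act ∘ (alg_one A ⊠ idm (dual D M)) = lunit (dual D M).
Proof.
apply: (right_perfect_uniq (@dual_coev_right _ D M)); rewrite !tensm_compr.
rewrite !(comp_eq _ codual_actP) -!comp_assoc assoc'_nat.
rewrite (comp_eq _ (esym (tensm_compl _ _ _))) ract_one.
by rewrite -triangle -!comp_assoc assoc'K comp_id_r.
Qed.

Definition codual_module : lmodule A := LModule codual_act_mul codual_act_one.

Lemma dual_coev_balanced : @balanced M codual_module (dual_coev D M).
Proof.
by rewrite /balanced (comp_eq _ codual_actP) -!comp_assoc assocK comp_id_r.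
Qed.
End RightDual.
End DualModules.

(** * Pairings and exact sequences of modules *)

Section Forget.
Context {C : coeq_braided_category} (A : comm_algebra C).
Local Notation a := (alg_ob (comm_alg A)).

Definition forget : functor (modules A) C :=
  @Functor (modules A) C (@mod_ob C A) (fun M N f => mod_map f)
    (fun M => erefl) (fun M N P g f => erefl).

Lemma forget_inj (M N : modules A) (f g : hom M N) :
  fmap forget f = fmap forget g -> f = g.
Proof. exact: module_hom_eq. Qed.

Lemma forget_iso (M N : modules A) (f : hom M N) :
  is_iso (fmap forget f) -> is_iso f.
Proof.
move=> [g [gf fg]]; exists (ModuleHom (module_inv gf fg)).
by split; apply: module_hom_eq.
Qed.

Lemma ract_hom_act (M N : lmodule A) (f : hom (M : C) N) :
  ract N ∘ (f ⊠ idm a) = f ∘ ract M -> f ∘ act M = act N ∘ (idm a ⊠ f).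
Proof.
have actE (T : lmodule A) : act T = ract T ∘ braid a T.
  by rewrite ractE -comp_assoc braidK comp_id_r.
by move=> E; rewrite !actE -comp_assoc braid_nat !comp_assoc E.
Qed.
End Forget.

Section ModulePairings.
Context {C : coeq_braided_category} (D : dualizing_object C) (A : comm_algebra C).
Local Notation a := (alg_ob (comm_alg A)).
Local Notation K := (dual_base D).
Variables (M N : lmodule A) (P : hom ((M : C) ⊗ N) K).
Hypothesis P_balanced : balanced P.

Let balanced_desc_exists :
  exists Q : hom (tensA M N : C) K, Q ∘ tensA_proj M N = P.
Proof.
have [|Q [QE _]] := (tensA_coequalizer M N).2 _ P; last by exists Q.
exact: P_balanced.
Qed.

Definition balanced_desc : hom (tensA M N : C) K :=
  projT1 (cid balanced_desc_exists).

Lemma balanced_descP : balanced_desc ∘ tensA_proj M N = P.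
Proof. exact: projT2 (cid balanced_desc_exists). Qed.

(** A morphism into a perfect partner is linear if the form it represents is
    balanced, so perfectness over the base passes to modules. *)
Lemma balanced_left_pairing :
  internal_hom P ->
  @left_pairing (modules A) C (forget A) K M N balanced_desc.
Proof.
move=> PU T f.
have [phi [phiE phiU]] := PU _ (f ∘ tensA_proj T N).
have phi_lin : phi ∘ act T = act M ∘ (idm a ⊠ phi).
  apply: ract_hom_act; apply: (internal_hom_uniq PU).
  rewrite !tensm_compl comp_assoc P_balanced -!comp_assoc assoc_nat tensm_id.
  rewrite (comp_eq2 _ (esym (tensm_swap _ _))) !(comp_eq _ phiE) -!comp_assoc.
  by rewrite tensA_proj_ract.
exists (ModuleHom phi_lin); split.
  apply: (@tensA_proj_epi _ _ T N); rewrite -comp_assoc.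
  rewrite (@tensA_mapP _ _ _ _ _ _ (ModuleHom phi_lin) (@idm (modules A) N)).
  by rewrite comp_assoc balanced_descP.
move=> psi psiE; apply: module_hom_eq => /=; apply: phiU.
rewrite -psiE -balanced_descP -!comp_assoc; congr (_ ∘ _).
by rewrite /= (@tensA_mapP _ _ _ _ _ _ psi (@idm (modules A) N)).
Qed.

Lemma balanced_right_pairing :
  right_perfect P ->
  @left_pairing (rev_monoidal (modules A)) C (forget A) K N M balanced_desc.
Proof.
move=> PU T f.
have [phi [phiE phiU]] := PU _ (f ∘ tensA_proj M T).
have phi_lin : phi ∘ act T = act N ∘ (idm a ⊠ phi).
  apply: (right_perfect_uniq PU); rewrite !tensm_compr.
  have P_balanced' : P ∘ (idm (M : C) ⊠ act N) =
      P ∘ (ract M ⊠ idm (N : C)) ∘ assoc' (M : C) a N.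
    by rewrite comp_assoc P_balanced -!comp_assoc assoc'K comp_id_r.
  rewrite (comp_eq2 _ P_balanced') -!comp_assoc assoc'_nat tensm_id.
  rewrite (comp_eq2 _ (tensm_swap _ _)) !(comp_eq _ phiE) -!comp_assoc.
  rewrite (comp_eq2 _ (tensA_proj_ract M T)) -!comp_assoc assoc'K.
  by rewrite comp_id_r.
exists (ModuleHom phi_lin); split.
  apply: (@tensA_proj_epi _ _ M T); rewrite -comp_assoc.
  rewrite (@tensA_mapP _ _ _ _ _ _ (@idm (modules A) M) (ModuleHom phi_lin)).
  by rewrite comp_assoc balanced_descP.
move=> psi psiE; apply: module_hom_eq => /=; apply: phiU.
rewrite -psiE -balanced_descP -!comp_assoc; congr (_ ∘ _).
by rewrite /= (@tensA_mapP _ _ _ _ _ _ (@idm (modules A) M) psi).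
Qed.
End ModulePairings.

Lemma balanced_desc_map (C : coeq_braided_category) (D : dualizing_object C)
    (A : comm_algebra C) (M N M1 N1 M2 N2 : lmodule A)
    (P1 : hom ((M1 : C) ⊗ N1) (dual_base D)) (P2 : hom ((M2 : C) ⊗ N2) (dual_base D))
    (P1b : balanced P1) (P2b : balanced P2)
    (f1 : module_hom M M1) (g1 : module_hom N N1)
    (f2 : module_hom M M2) (g2 : module_hom N N2) :
  balanced_desc P1b ∘ mod_map (tensA_map f1 g1) =
    balanced_desc P2b ∘ mod_map (tensA_map f2 g2) ->
  P1 ∘ (mod_map f1 ⊠ mod_map g1) = P2 ∘ (mod_map f2 ⊠ mod_map g2).
Proof.
move=> /(congr1 (fun t => t ∘ tensA_proj M N)); rewrite -!comp_assoc !tensA_mapP.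
by rewrite !comp_assoc !balanced_descP.
Qed.

Section ModuleExactness.
Context {k : fieldType} {C : ribbon_GV_category k} (A : comm_algebra C).
Local Notation L := (lfa_linear (rgv_lfa C)).
Local Notation a := (alg_ob (comm_alg A)).
Local Notation D := (ribbon_dualizing C).
Implicit Types M N T : lmodule A.

Let Lab : is_abelian L := lfa_abelian (rgv_lfa C).

Fact zero_module_hom_act M N :
  (zerom (C := L) M N : hom (M : C) N) ∘ act M =
  act N ∘ (idm a ⊠ (zerom (C := L) M N : hom (M : C) N)).
Proof.
by rewrite (@tensm_zeror k C a a M N) (@zerom_comp k L) (@comp_zerom k L).
Qed.

Definition zero_module_hom M N : module_hom M N :=
  ModuleHom (zero_module_hom_act M N).

Lemma zero_module M : zero_object (C := L) M -> @zero_object (modules A) M.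
Proof.
move=> M0 N; split.
  by exists (zero_module_hom N M); split=> // f _; exact/module_hom_eq/hom_zero_object.
by exists (zero_module_hom M N); split=> // f _; exact/module_hom_eq/zero_object_hom.
Qed.

Lemma kernel_module M N (f : module_hom M N) :
  exists T (i : module_hom T M), is_kernel (C := L) (mod_map i) (mod_map f).
Proof.
have [X [i iK]] : exists (X : C) (i : hom X (M : C)),
    is_kernel (C := L) i (mod_map f) := abelian_kernel Lab (mod_map f).
have iM : is_mono (C := C) i := kernel_mono iK.
have [s sE] : exists s : hom (a ⊗ X) X, i ∘ s = act M ∘ (idm a ⊠ i).
  apply: (kernel_lift (h := act M ∘ (idm a ⊠ i) : hom (a ⊗ X) (M : C)) iK).
  have -> : mod_map f ∘ (act M ∘ (idm a ⊠ i)) =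
      act N ∘ (idm a ⊠ (mod_map f ∘ i)).
    by rewrite comp_assoc mod_map_act tensm_compr comp_assoc.
  by have [-> _] := iK; rewrite (@tensm_zeror k C a a X N) (@comp_zerom k L).
have s_mul : s ∘ (alg_mul A ⊠ idm (X : C)) = s ∘ (idm a ⊠ s) ∘ assoc a a X.
  apply: iM; rewrite !comp_assoc sE -!comp_assoc -tensm_swap.
  rewrite (comp_eq2 _ (act_mul M)) -!comp_assoc -(tensm_id a a) assoc_nat.
  by rewrite !(comp_eq _ (esym (tensm_compr _ _ _))) sE.
have s_one : s ∘ (alg_one A ⊠ idm (X : C)) = lunit (X : C).
  apply: iM; rewrite comp_assoc sE -comp_assoc -tensm_swap comp_assoc act_one.
  by rewrite lunit_nat.
pose T := @LModule C A X s s_mul s_one.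
by exists T, (@ModuleHom C A T M i sE).
Qed.

Lemma cokernel_module M N (f : module_hom M N) :
  exists T (p : module_hom N T), is_cokernel (C := L) (mod_map p) (mod_map f).
Proof.
have [X [p pC]] : exists (X : C) (p : hom (N : C) X),
    is_cokernel (C := L) p (mod_map f) := abelian_cokernel Lab (mod_map f).
have apC := tensm_cokernel_r a pC.
have aapE : is_epi (C := C) (idm (a ⊗ a) ⊠ p) :=
  cokernel_epi (tensm_cokernel_r (a ⊗ a) pC).
have pE : is_epi (C := C) (idm munit ⊠ p) :=
  cokernel_epi (tensm_cokernel_r munit pC).
have [s sE] : exists s : hom (a ⊗ X) X, s ∘ (idm a ⊠ p) = p ∘ act N.
  apply: (cokernel_desc (h := p ∘ act N : hom (a ⊗ (N : C)) X) apC).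
  have -> : (p ∘ act N) ∘ (idm a ⊠ mod_map f) = (p ∘ mod_map f) ∘ act M.
    by rewrite -!comp_assoc mod_map_act.
  by have [-> _] := pC; rewrite (@zerom_comp k L).
have s_mul : s ∘ (alg_mul A ⊠ idm (X : C)) = s ∘ (idm a ⊠ s) ∘ assoc a a X.
  apply: aapE; rewrite -!comp_assoc tensm_swap (comp_eq _ sE) -!comp_assoc.
  rewrite act_mul.
  rewrite -(tensm_id a a) assoc_nat (comp_eq _ (esym (tensm_compr _ _ _))) sE.
  by rewrite tensm_compr -comp_assoc (comp_eq _ sE) -comp_assoc.
have s_one : s ∘ (alg_one A ⊠ idm (X : C)) = lunit (X : C).
  apply: pE; rewrite -comp_assoc tensm_swap (comp_eq _ sE) -comp_assoc act_one.
  by rewrite lunit_nat.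
pose T := @LModule C A X s s_mul s_one.
by exists T, (@ModuleHom C A N T p (esym sE)).
Qed.

(** The kernel in [C] of a morphism of modules is a submodule, so it vanishes for
    a monomorphism of modules. *)
Lemma forget_mono (M N : modules A) (f : hom M N) :
  is_mono f <-> is_mono (C := L) (fmap (forget A) f).
Proof.
split=> fM; last first.
  by move=> T u v E; apply/forget_inj/fM; rewrite -[LHS]/(fmap (forget A) (f ∘ u)) E.
have [T [i iK]] := kernel_module f.
have i0 : i = zero_module_hom T M.
  apply: fM; apply: module_hom_eq => /=; rewrite iK.1.
  by rewrite (@comp_zerom k L).
apply: mono_zero => X u fu.
have [v <-] := kernel_lift iK fu.
by rewrite i0 /= (@zerom_comp k L).
Qed.

(** A map out of the tensor product over [A] that vanishes on the image of [f]
    descends to the tensor product of [T] and [S] in [C]. The map obtained is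
    balanced because [p] stays epi after tensoring in [C]. *)
Lemma tensA_cokernel_l M N T S (f : module_hom M N) (p : module_hom N T) :
  is_cokernel (C := L) (mod_map p) (mod_map f) ->
  is_cokernel (C := L) (mod_map (tensA_map p (@idm (modules A) S)))
                       (mod_map (tensA_map f (@idm (modules A) S))).
Proof.
move=> pC.
have pS := tensm_cokernel_l S pC.
have pSE : is_epi (C := C) (mod_map p ⊠ idm (S : C)) := cokernel_epi pS.
have paSE : is_epi (C := C) ((mod_map p ⊠ idm a) ⊠ idm (S : C)).
  exact: cokernel_epi (tensm_cokernel_l S (tensm_cokernel_l a pC)).
have mapP M' N' (g : module_hom M' N') :
    mod_map (tensA_map g (@idm (modules A) S)) ∘ tensA_proj M' S =
    tensA_proj N' S ∘ (mod_map g ⊠ idm (S : C)) by exact: tensA_mapP.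
apply: cokernelI.
- move=> X u v E; apply: (@tensA_proj_epi _ _ T S); apply: pSE.
  by rewrite -!comp_assoc -mapP !comp_assoc E.
- apply: (@tensA_proj_epi _ _ M S); rewrite -comp_assoc mapP comp_assoc mapP.
  rewrite -comp_assoc (pS.1 : (mod_map p ⊠ idm (S : C)) ∘ _ = _).
  by rewrite (@comp_zerom k L) (@zerom_comp k L).
move=> X h hf.
suff [v vE] : exists v : @hom C (tensA T S) X,
    v ∘ mod_map (tensA_map p (@idm (modules A) S)) = h by exists v.
have [u uE] : exists u : @hom C ((T : C) ⊗ S) X,
    u ∘ (mod_map p ⊠ idm (S : C)) = (h : @hom C (tensA N S) X) ∘ tensA_proj N S.
  apply: (cokernel_desc (h := h ∘ tensA_proj N S) pS).
  have := congr1 (fun t => t ∘ tensA_proj M S)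
    (hf : (h : @hom C (tensA N S) X) ∘ mod_map _ = zerom (C := L) _ _).
  by rewrite -!comp_assoc mapP (@zerom_comp k L).
have [|v [vE _]] := (tensA_coequalizer T S).2 _ u.
  apply: paSE; rewrite -!comp_assoc -tensm_compl ract_hom tensm_compl.
  rewrite (comp_eq _ uE) assoc_nat tensm_id -(comp_eq2 _ (tensm_swap _ _)).
  by rewrite (comp_eq _ uE) -!comp_assoc tensA_proj_ract.
exists v; apply: (@tensA_proj_epi _ _ N S).
by rewrite -comp_assoc mapP comp_assoc vE.
Qed.

Lemma tensA_cokernel_r M N T S (f : module_hom M N) (p : module_hom N T) :
  is_cokernel (C := L) (mod_map p) (mod_map f) ->
  is_cokernel (C := L) (mod_map (tensA_map (@idm (modules A) S) p))
                       (mod_map (tensA_map (@idm (modules A) S) f)).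
Proof.
move=> pC.
have pS := tensm_cokernel_r S pC.
have pSE : is_epi (C := C) (idm (S : C) ⊠ mod_map p) := cokernel_epi pS.
have paSE : is_epi (C := C) (idm ((S : C) ⊗ a) ⊠ mod_map p).
  exact: cokernel_epi (tensm_cokernel_r ((S : C) ⊗ a) pC).
have mapP M' N' (g : module_hom M' N') :
    mod_map (tensA_map (@idm (modules A) S) g) ∘ tensA_proj S M' =
    tensA_proj S N' ∘ (idm (S : C) ⊠ mod_map g) by exact: tensA_mapP.
apply: cokernelI.
- move=> X u v E; apply: (@tensA_proj_epi _ _ S T); apply: pSE.
  by rewrite -!comp_assoc -mapP !comp_assoc E.
- apply: (@tensA_proj_epi _ _ S M); rewrite -comp_assoc mapP comp_assoc mapP.
  rewrite -comp_assoc (pS.1 : (idm (S : C) ⊠ mod_map p) ∘ _ = _).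
  by rewrite (@comp_zerom k L) (@zerom_comp k L).
move=> X h hf.
suff [v vE] : exists v : @hom C (tensA S T) X,
    v ∘ mod_map (tensA_map (@idm (modules A) S) p) = h by exists v.
have [u uE] : exists u : @hom C ((S : C) ⊗ T) X,
    u ∘ (idm (S : C) ⊠ mod_map p) = (h : @hom C (tensA S N) X) ∘ tensA_proj S N.
  apply: (cokernel_desc (h := h ∘ tensA_proj S N) pS).
  have := congr1 (fun t => t ∘ tensA_proj S M)
    (hf : (h : @hom C (tensA S N) X) ∘ mod_map _ = zerom (C := L) _ _).
  by rewrite -!comp_assoc mapP (@zerom_comp k L).
have [|v [vE _]] := (tensA_coequalizer S T).2 _ u.
  apply: paSE; rewrite -!comp_assoc tensm_swap (comp_eq _ uE).
  rewrite -(tensm_id (S : C) a) assoc_nat.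
  rewrite (comp_eq _ (esym (tensm_compr _ _ _))) -mod_map_act tensm_compr.
  by rewrite -!comp_assoc (comp_eq _ uE) -!comp_assoc tensA_proj_ract.
exists v; apply: (@tensA_proj_epi _ _ S N).
by rewrite -comp_assoc mapP comp_assoc vE.
Qed.
End ModuleExactness.

(** * Duals and extensions of modules *)

Section ModuleDuals.
Variables (k : fieldType) (C : ribbon_GV_category k) (A : comm_algebra C).
Local Notation L := (lfa_linear (rgv_lfa C)).
Local Notation a := (alg_ob (comm_alg A)).
Local Notation D := (ribbon_dualizing C).
Local Notation E := (modules A).

Let Lab : is_abelian L := lfa_abelian (rgv_lfa C).

Lemma dual_module_transpose (M N : E) (f : hom M N)
    (f' : module_hom (dual_module D N) (dual_module D M)) :
  @is_transpose k L E (forget A) (dual_base D) (@dual_module C D A)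
    (fun T => balanced_desc (@dual_ev_balanced C D A T)) M N f f' ->
  mod_map f' = dual_map D (mod_map f).
Proof.
move=> E1; symmetry; apply: curry_uniq.
exact: (balanced_desc_map (g1 := @idm E M) (f2 := @idm E (dual_module D N)) E1).
Qed.

Lemma codual_module_transpose (M N : E) (f : hom M N)
    (f' : module_hom (codual_module D N) (codual_module D M)) :
  @is_transpose k L (rev_monoidal E) (forget A) (dual_base D) (@codual_module C D A)
    (fun T => balanced_desc (@dual_coev_balanced C D A T)) M N f f' ->
  mod_map f' = dual_map D (mod_map f).
Proof.
move=> E1; apply: (right_perfect_uniq (@dual_coev_right _ D M)).
rewrite dual_coev_map.
exact: (balanced_desc_map (f1 := @idm E M) (g2 := @idm E (codual_module D N)) E1).
Qed.

(** Here the unit module is paired with its codual, so it is the codual that must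
    have a dual for tensoring with it to be exact. *)
Lemma module_left_dual_extension (M' M M'' : E) (i : hom M' M) (p : hom M M'') :
  (exists Y : E, is_left_dual (codual_module D (unitA A) : E) Y) ->
  is_kernel (C := L) (mod_map i) (mod_map p) ->
  is_cokernel (C := L) (mod_map p) (mod_map i) ->
  (exists Y, is_left_dual Y M') -> (exists Y, is_left_dual Y M'') ->
  exists Y, is_left_dual Y M.
Proof.
move=> [Y1 W1Y1].
apply: (@left_dual_extension k L Lab E (forget A) (dual_base D)
  (@forget_iso C A) (@forget_mono k C A)
  (fun X Y Q Z f q => @tensA_cokernel_l k C A X Y Q Z f q)
  (fun X Y Q Z f q => @tensA_cokernel_r k C A X Y Q Z f q)
  (@dual_module C D A)
  (fun T => balanced_desc (@dual_ev_balanced C D A T)) _ _ _ _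
  (codual_module D (unitA A)) Y1
  (balanced_desc (@dual_coev_balanced C D A (unitA A))) _ W1Y1).
- by move=> N; apply: balanced_left_pairing; exact: dual_ev_left.
- move=> X Y Q f q f' q' /dual_module_transpose E1 /dual_module_transpose E2 /=.
  by rewrite E1 E2; exact: dual_map_kernel.
- move=> X Y Q f q f' q' /dual_module_transpose E1 /dual_module_transpose E2 /=.
  by rewrite E1 E2; exact: dual_map_cokernel.
- move=> Z; exists (codual_module D Z), (balanced_desc (@dual_coev_balanced C D A Z)).
  by apply: balanced_left_pairing; exact: dual_coev_left.
by apply: balanced_left_pairing; exact: dual_coev_left.
Qed.

(** In the reversed category [dual_module] and [codual_module] exchange their
    roles. *)
Lemma module_right_dual_extension (M' M M'' : E) (i : hom M' M) (p : hom M M'') :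
  (exists Y : E, is_left_dual Y (dual_module D (unitA A) : E)) ->
  is_kernel (C := L) (mod_map i) (mod_map p) ->
  is_cokernel (C := L) (mod_map p) (mod_map i) ->
  (exists Y, is_left_dual M' Y) -> (exists Y, is_left_dual M'' Y) ->
  exists Y, is_left_dual M Y.
Proof.
move=> [Y1 /rev_left_dual W1Y1] iK pC.
move=> [Y' /rev_left_dual M'Y'] [Y'' /rev_left_dual M''Y''].
suff [Y /rev_left_dual MY] : exists Y, @is_left_dual (rev_monoidal E) Y M by exists Y.
apply: (@left_dual_extension k L Lab (rev_monoidal E) (forget A) (dual_base D)
  (@forget_iso C A) (@forget_mono k C A)
  (fun X Y Q Z f q => @tensA_cokernel_r k C A X Y Q Z f q)
  (fun X Y Q Z f q => @tensA_cokernel_l k C A X Y Q Z f q)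
  (@codual_module C D A)
  (fun T => balanced_desc (@dual_coev_balanced C D A T)) _ _ _ _
  (dual_module D (unitA A)) Y1
  (balanced_desc (@dual_ev_balanced C D A (unitA A))) _ W1Y1 M' M M'' i p iK pC).
- by move=> N; apply: balanced_right_pairing; exact: dual_coev_right.
- move=> X Y Q f q f' q' /codual_module_transpose E1 /codual_module_transpose E2 /=.
  by rewrite E1 E2; exact: dual_map_kernel.
- move=> X Y Q f q f' q' /codual_module_transpose E1 /codual_module_transpose E2 /=.
  by rewrite E1 E2; exact: dual_map_cokernel.
- move=> Z; exists (dual_module D Z), (balanced_desc (@dual_ev_balanced C D A Z)).
  by apply: balanced_right_pairing; exact: dual_ev_right.
- by apply: balanced_right_pairing; exact: dual_ev_right.
- by exists Y'.
by exists Y''.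
Qed.

(** Induction on the length of the underlying object: a proper nonzero submodule
    and the corresponding quotient both have smaller length. *)
Lemma module_devissage (Pr : E -> Prop) :
  (forall M, zero_object M -> Pr M) -> (forall M, simple_object M -> Pr M) ->
  (forall (M' M M'' : E) (i : hom M' M) (p : hom M M''),
    is_kernel (C := L) (mod_map i) (mod_map p) ->
    is_cokernel (C := L) (mod_map p) (mod_map i) -> Pr M' -> Pr M'' -> Pr M) ->
  forall M, Pr M.
Proof.
move=> Pr0 PrS PrE M.
have [n nM] := finite_length_le (lfa_finite_length ((M : C) : L)).
elim/ltn_ind: n M nM => n IH M nM.
(* If [Pr] failed at [M], the induction hypothesis would make [M] simple. *)
apply: contrapT => nPr; apply: (nPr); apply: PrS; split.
  by move=> M0; apply: nPr; exact: Pr0.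
move=> N i iM; apply: contrapT => /not_orP [N0 iI]; apply: nPr.
have [T [p pC]] := cokernel_module i.
have iK := mono_kernel Lab ((forget_mono i).1 iM) pC.
have [b [c [bN cT bcn]]] := length_le_split Lab nM iK (cokernel_epi pC).
have b_gt0 : 0 < b.
  by case: b bN {bcn} => // /length_le0 N0'; case: N0; exact: zero_module.
have c_gt0 : 0 < c.
  case: c cT {bcn} => // /length_le0 T0; case: iI; apply: forget_iso.
  apply: (mono_epi_iso Lab); first exact/forget_mono.
  apply: epi_zero => Z u ui; have [w <-] := cokernel_desc pC ui.
  by rewrite (zero_object_hom w (zerom _ _) T0) zerom_comp.
apply: PrE iK pC _ _; [apply: (IH b)|apply: (IH c)] => //.
  by apply: leq_trans bcn; rewrite -addn1 leq_add2l.
by apply: leq_trans bcn; rewrite -add1n leq_add2r.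
Qed.
End ModuleDuals.

(** * Locality of dual modules *)

Section Locality.
Variables (k : fieldType) (C : ribbon_GV_category k) (A : comm_algebra C).
Local Notation a := (alg_ob (comm_alg A)).
Local Notation D := (ribbon_dualizing C).
Local Notation K := (dual_base D).

(** The twist, typed as an endomorphism of [X] instead of a morphism between
    values of the identity functor. *)
Definition theta (X : C) : hom X X := rgv_twist C X.
Local Notation θ := theta.

Lemma theta_nat (X Y : C) (f : hom X Y) : θ Y ∘ f = f ∘ θ X.
Proof. exact: (nat_mapP (rgv_twist C) f). Qed.

Lemma theta_iso (X : C) : is_iso (θ X).
Proof. exact: (nat_map_iso (rgv_twist C) X). Qed.

Lemma theta_tens (X Y : C) : θ (X ⊗ Y) = braid Y X ∘ braid X Y ∘ (θ X ⊠ θ Y).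
Proof. exact: (twist_tens (rgv_twist C) X Y). Qed.

Lemma theta_dual (X : C) : dual_map D (θ X) = θ (dual D X).
Proof. exact: (twist_dual (rgv_twist C) X). Qed.

(** The balancing identity turns the double braiding of [A] with [M] into the
    failure of the twist to be multiplicative on the action. *)
Lemma is_local_theta (M : lmodule A) :
  is_local M <-> θ (M : C) ∘ act M = act M ∘ (θ a ⊠ θ (M : C)).
Proof.
rewrite theta_nat theta_tens /is_local; split=> [E|E].
  by rewrite (comp_eq3 _ E).
have tE : is_epi (θ a ⊠ θ (M : C)).
  have [s [_ ts]] := theta_iso a; have [s' [_ ts']] := theta_iso (M : C).
  by apply: (@split_epi _ _ _ _ (s ⊠ s')); rewrite -tensm_comp ts ts' tensm_id.
by apply: tE; rewrite -!comp_assoc.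
Qed.

Lemma is_local_theta_ract (M : lmodule A) :
  is_local M <-> θ (M : C) ∘ ract M = ract M ∘ (θ (M : C) ⊠ θ a).
Proof.
rewrite is_local_theta; split=> E.
  by rewrite ractE comp_assoc E -!comp_assoc braid'_nat.
have actE : act M = ract M ∘ braid a M.
  by rewrite ractE -comp_assoc braidK comp_id_r.
by rewrite actE comp_assoc E -!comp_assoc braid_nat.
Qed.

Hypothesis theta_sq : θ a ∘ θ a = idm a.

Section Pairing.
Variables (M N : lmodule A) (P : hom ((M : C) ⊗ N) K).
Hypothesis P_balanced : balanced P.
Hypothesis P_theta :
  P ∘ (θ (M : C) ⊠ idm (N : C)) = P ∘ (idm (M : C) ⊠ θ (N : C)).

(** Locality says that the twist is multiplicative on the action. Transposed
    along a pairing for which the twists of [M] and [N] are adjoint, this becomes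
    the same statement for the other module, except that the twist of the algebra
    moves to the other side of the equation and so enters squared. *)
Lemma is_local_right_partner : right_perfect P -> is_local M -> is_local N.
Proof.
move=> PU /is_local_theta_ract Ml; apply/is_local_theta.
have Pact : P ∘ (idm (M : C) ⊠ act N) =
    P ∘ (ract M ⊠ idm (N : C)) ∘ assoc' (M : C) a N.
  by rewrite comp_assoc P_balanced -!comp_assoc assoc'K comp_id_r.
apply: (right_perfect_uniq PU); rewrite !tensm_compr.
rewrite (comp_eq2 _ (esym P_theta)) tensm_swap (comp_eq2 _ Pact).
rewrite [RHS](comp_eq2 _ Pact) -!comp_assoc !assoc'_nat.
rewrite -(tensm_id a (N : C)) assoc'_nat (comp_eq _ (esym (tensm_compl _ _ _))).
rewrite (tensm_rl (idm (M : C) ⊠ θ a) (θ (N : C))) -!comp_assoc.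
rewrite (comp_eq2 _ (tensm_swap _ _)) (comp_eq2 _ (esym P_theta)).
rewrite !(comp_eq _ (esym (tensm_compl _ _ _))) -!comp_assoc.
by rewrite (comp_eq _ Ml) -!comp_assoc -tensm_comp theta_sq comp_id_r.
Qed.

Lemma is_local_left_partner : internal_hom P -> is_local N -> is_local M.
Proof.
move=> PU /is_local_theta Nl; apply/is_local_theta_ract.
apply: (internal_hom_uniq PU); rewrite !tensm_compl.
rewrite (comp_eq2 _ P_theta) -tensm_swap !(comp_eq _ P_balanced) -!comp_assoc.
rewrite assoc_nat -(tensm_id (M : C) a) assoc_nat.
rewrite (tensm_lr (θ (M : C)) (θ a ⊠ idm (N : C))) -!comp_assoc.
rewrite (comp_eq2 _ (esym (tensm_swap _ _))) (comp_eq2 _ P_theta).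
rewrite !(comp_eq _ (esym (tensm_compr _ _ _))) -!comp_assoc.
by rewrite (comp_eq _ Nl) -!comp_assoc -tensm_comp theta_sq comp_id_r.
Qed.
End Pairing.

Lemma dual_ev_theta (X : C) :
  dual_ev D X ∘ (θ (dual D X) ⊠ idm X) = dual_ev D X ∘ (idm (dual D X) ⊠ θ X).
Proof. by rewrite -theta_dual dual_mapP. Qed.

Lemma dual_coev_theta (X : C) :
  dual_coev D X ∘ (θ X ⊠ idm (dual D X)) =
  dual_coev D X ∘ (idm X ⊠ θ (dual D X)).
Proof. by rewrite -theta_dual dual_coev_map. Qed.

Lemma dual_module_local (M : lmodule A) : is_local M -> is_local (dual_module D M).
Proof.
apply: (is_local_left_partner (@dual_ev_balanced C D A M) (dual_ev_theta M)).
exact: dual_ev_left.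
Qed.

Lemma codual_module_local (M : lmodule A) :
  is_local M -> is_local (codual_module D M).
Proof.
apply: (is_local_right_partner (@dual_coev_balanced C D A M) (dual_coev_theta M)).
exact: dual_coev_right.
Qed.
End Locality.

(** * Rigidity *)

Lemma full_monoidal_left_dual (E : monoidal_category) (S : E -> Prop)
    (S1 : S munit) (St : forall X Y, S X -> S Y -> S (X ⊗ Y))
    (X Y : full_monoidal S1 St) :
  is_left_dual Y X -> is_left_dual (sval Y) (sval X).
Proof.
by case=> ev [coev [zig zag]]; exists ev, coev; split; [exact: zig|exact: zag].
Qed.

Lemma local_duals (C : coeq_braided_category) (A : comm_algebra C) (M : modules A) :
  rigid (local_modules A) -> is_local M ->
  (exists Y : modules A, is_left_dual Y M) /\ (exists Y : modules A, is_left_dual M Y).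
Proof.
move=> loc_rigid Ml; have [[Y YM] [Z MZ]] := loc_rigid (exist _ M Ml).
split; [exists (sval Y)|exists (sval Z)].
  exact: (full_monoidal_left_dual YM).
exact: (full_monoidal_left_dual MZ).
Qed.

Lemma zero_object_left_dual (E : monoidal_category) (M : E) :
  zero_object M -> is_left_dual M M.
Proof.
move=> M0; have [_ [u _]] := M0 munit; have [[v _] _] := M0 munit.
have M_uniq X (f g : hom X M) : f = g.
  by have [[w [_ wU]] _] := M0 X; rewrite -(wU f) // (wU g).
exists (lunit munit ∘ (u ⊠ u)), ((v ⊠ v) ∘ lunit' munit).
by split; exact: M_uniq.
Qed.

Theorem theorem3p14 (k : fieldType) (C : ribbon_GV_category k)
    (A : comm_algebra C)
    (twistA : rgv_twist C A ∘ rgv_twist C A = idm (A : C))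
    (rigid_loc : rigid (local_modules A))
    (simple_loc : forall M : modules A, simple_object M -> is_local M) :
  rigid (modules A).
Proof.
have unit_loc := @is_local_unit C A.
have [_ dual_unit] := local_duals rigid_loc (codual_module_local twistA unit_loc).
have [unit_dual _] := local_duals rigid_loc (dual_module_local twistA unit_loc).
move=> M; split; elim/module_devissage: M.
- by move=> M M0; exists M; exact: zero_object_left_dual.
- by move=> M /simple_loc Ml; have [] := local_duals rigid_loc Ml.
- by move=> M' M M'' i p; exact: module_left_dual_extension.
- by move=> M M0; exists M; exact: zero_object_left_dual.
- by move=> M /simple_loc Ml; have [] := local_duals rigid_loc Ml.
by move=> M' M M'' i p; exact: module_right_dual_extension.
Qed.
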